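(* Let $m,n\ge 2$ be integers and $R=[0,m-1]\times[0,n-1]$. There are bijections $\Phi_b:\ker BW\setminus\{0\}\to\mathcal{T}_b$ and $\Phi_w:\ker WB\setminus\{0\}\to\mathcal{T}_w$.
   Context: Let $G=R\cap(\mathbb{Z}\times\mathbb{Z})$ be the $m\times n$ rectangular graph, where $(x,y),(x',y')$ are adjacent iff $|x-x'|+|y-y'|=1$. A point $(x,y)$ is black if $x+y$ is even and white otherwise. Let $V_b$ (resp. $V_w$) be the $\mathbb{Z}/(2)$-vector space of functions on the black (resp. white) points of $G$. $BW:V_b\to V_w$ is the black-to-white adjacency map, $(BWu)(w)=\sum_{b \text{ black neighbor of } w}u(b) \pmod 2$, and $WB:V_w\to V_b$ is defined analogously. The tiles are the following closed polygons, where $a,b$ denote arbitrary positive integers; each tile may be translated and rotated by integer multiples of $\pi/2$. (T1) An axis-parallel square of side $2$. (T2) A square of side $\sqrt2$ with sides in the diagonal directions, e.g. with vertices $(0,0),(1,1),(0,2),(-1,1)$. (T3) The octagon with vertices $(0,0),(2,0),(2+a,a),(2+a,a+2),(2+a-b,a+b+2),(a-b,a+b+2),(-b,b+2),(-b,b)$. (T4) The hexagon with vertices $(0,0),(2,0),(2,2),(2-a,2+a),(-a,2+a),(-a,a)$. (T5) The trapezoid with vertices $(0,0),(2a+2,0),(a+2,a),(a,a)$, whose long base is called dashed. (T6) The right isosceles triangle with vertices $(0,0),(a,0),(0,a)$, whose two legs are called dashed. A tiling of $R$ is a covering of $R$ by finitely many such tiles with pairwise disjoint interiors such that every dashed side is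 contained in $\partial R$. In any tiling, all tile vertices are integral; the color of a tile is the common color of its vertices, except that for a triangle (T6) it is the color of its two vertices not at the right angle. $\mathcal{T}_b$ (resp. $\mathcal{T}_w$) is the set of tilings of $R$ all of whose tiles are black (resp. white). *)

(* Defs.v *)
From HB Require Import structures.
From mathcomp Require Import all_boot all_order all_algebra.
From mathcomp Require Import all_classical all_reals all_analysis.

Set Implicit Arguments.
Unset Strict Implicit.
Unset Printing Implicit Defensive.

Import Order.TTheory GRing.Theory Num.Theory.
Import numFieldNormedType.Exports.

Local Open Scope classical_set_scope.
Local Open Scope ring_scope.

(* The vertex (i, j) of the m x n grid graph is the lattice point (i, j) of
   [0, m - 1] x [0, n - 1]. *)
Definition grid_point (m n : nat) := ('I_m * 'I_n)%type.

Definition adj m n (p q : grid_point m n) : bool :=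
  (`|p.1%:Z - q.1%:Z| + `|p.2%:Z - q.2%:Z| == 1).

Definition black m n (p : grid_point m n) : bool := ~~ odd (p.1 + p.2).
Definition white m n (p : grid_point m n) : bool := ~~ black p.

Definition Vb m n := {ffun {p : grid_point m n | black p} -> 'F_2}.
Definition Vw m n := {ffun {p : grid_point m n | white p} -> 'F_2}.

Definition BW m n (u : Vb m n) : Vw m n :=
  [ffun w => \sum_(b | adj (val b) (val w)) u b].
Definition WB m n (u : Vw m n) : Vb m n :=
  [ffun b => \sum_(w | adj (val w) (val b)) u w].

Definition kerBW m n : set (Vb m n) := [set u | BW u = 0].
Definition kerWB m n : set (Vw m n) := [set u | WB u = 0].
Arguments kerBW m n : clear implicits.
Arguments kerWB m n : clear implicits.

Inductive prototile : Type :=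
| Square
| Diamond
| Octagon of nat & nat
| Hexagon of nat
| Trapezoid of nat
| Triangle of nat.

Definition proto_ok (s : prototile) : bool :=
  match s with
  | Square | Diamond => true
  | Octagon a b => (0 < a)%N && (0 < b)%N
  | Hexagon a | Trapezoid a | Triangle a => (0 < a)%N
  end.

Section Plane.
Context {R : realType}.
Implicit Types (p v : R * R) (vs : seq (R * R)) (A D : set (R * R)).

Definition conv_hull vs : set (R * R) :=
  [set p | exists c : 'I_(size vs) -> R,
    [/\ forall i, 0 <= c i,
        \sum_i c i = 1,
        p.1 = \sum_i c i * (vs`_i).1 &
        p.2 = \sum_i c i * (vs`_i).2]].

Definition boundary A : set (R * R) := closure A `\` interior A.

Definition proto_vertices (s : prototile) : seq (R * R) :=
  match s with
  | Square => [:: (0, 0); (2, 0); (2, 2); (0, 2)]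
  | Diamond => [:: (0, 0); (1, 1); (0, 2); (-1, 1)]
  | Octagon a' b' => let a : R := a'%:R in let b : R := b'%:R in
      [:: (0, 0); (2, 0); (2 + a, a); (2 + a, a + 2);
          (2 + a - b, a + b + 2); (a - b, a + b + 2); (- b, b + 2); (- b, b)]
  | Hexagon a' => let a : R := a'%:R in
      [:: (0, 0); (2, 0); (2, 2); (2 - a, 2 + a); (- a, 2 + a); (- a, a)]
  | Trapezoid a' => let a : R := a'%:R in
      [:: (0, 0); (2 * a + 2, 0); (a + 2, a); (a, a)]
  | Triangle a' => let a : R := a'%:R in
      [:: (0, 0); (a, 0); (0, a)]
  end.

Definition proto_dashed (s : prototile) : seq ((R * R) * (R * R)) :=
  match s with
  | Trapezoid a' => let a : R := a'%:R in [:: ((0, 0), (2 * a + 2, 0))]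
  | Triangle a' => let a : R := a'%:R in
      [:: ((0, 0), (a, 0)); ((0, 0), (0, a))]
  | _ => [::]
  end.

(* The vertices which determine the color: all of them, except that the
   right-angle vertex of a triangle is ignored. *)
Definition proto_color_vertices (s : prototile) : seq (R * R) :=
  if s is Triangle _ then behead (proto_vertices s) else proto_vertices s.

Definition quarter_turn p : R * R := (- p.2, p.1).

Record tile : Type := Tile {
  tile_proto : prototile;
  tile_turns : nat;
  tile_shift : R * R;
  tile_ok : proto_ok tile_proto }.

Definition place (t : tile) p : R * R :=
  let q := iter (tile_turns t) quarter_turn p in
  (q.1 + (tile_shift t).1, q.2 + (tile_shift t).2).

(* All six shapes are convex, so the closed polygon is the convex hull of its
   vertices. *)
Definition tile_region (t : tile) : set (R * R) :=
  conv_hull [seq place t v | v <- proto_vertices (tile_proto t)].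

Definition dashed_side (t : tile) A : Prop :=
  exists2 e, e \in proto_dashed (tile_proto t) &
    A = conv_hull [:: place t e.1; place t e.2].

(* A tiling is the set of its closed polygons.  Different values of type tile
   may have the same region (the square under quarter turns, for instance);
   identifying tiles with their regions counts them only once. *)
Definition tiling D (T : set (set (R * R))) : Prop :=
  [/\ finite_set T,
      T `<=` range tile_region,
      \bigcup_(P in T) P = D,
      trivIset T (fun P => interior P) &
      forall t A, T (tile_region t) -> dashed_side t A -> A `<=` boundary D].

Definition black_point p : Prop :=
  exists x y : int, p = (x%:~R, y%:~R) /\ (2 %| x + y)%Z.
Definition white_point p : Prop :=
  exists x y : int, p = (x%:~R, y%:~R) /\ ~~ (2 %| x + y)%Z.

Definition black_tile (t : tile) : Prop :=
  forall v, v \in proto_color_vertices (tile_proto t) ->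
    black_point (place t v).
Definition white_tile (t : tile) : Prop :=
  forall v, v \in proto_color_vertices (tile_proto t) ->
    white_point (place t v).

Definition black_tilings D : set (set (set (R * R))) :=
  [set T | tiling D T /\ forall t, T (tile_region t) -> black_tile t].
Definition white_tilings D : set (set (set (R * R))) :=
  [set T | tiling D T /\ forall t, T (tile_region t) -> white_tile t].

End Plane.

Definition rectangle (R : realType) (m n : nat) : set (R * R) :=
  [set p | 0 <= p.1 <= m%:R - 1 /\ 0 <= p.2 <= n%:R - 1].
Arguments rectangle R m n : clear implicits.

(* Main.v *)
Require Import Defs.
From mathcomp Require Import all_boot all_order all_algebra.
From mathcomp Require Import all_classical all_reals all_analysis.
From mathcomp Require Import zify ring lra.

Set Implicit Arguments.
Unset Strict Implicit.
Unset Printing Implicit Defensive.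

Import Order.TTheory GRing.Theory Num.Theory.
Import numFieldNormedType.Exports.

Local Open Scope ring_scope.

(** A kernel function [u], extended by zero to the lines at distance 1 outside
    the rectangle and then by reflection in these lines, satisfies the kernel
    condition on the whole lattice.  In the diagonal coordinates of the coloured
    points this condition says that the sum over every unit cell vanishes, so
    the extension has the form [F i + G j], and its zeros on the reflection
    lines force [G j = F (j - 1)] with [F] periodic and symmetric.  Hence the
    zeros form blocks, run of [F] times run of [F], and two such runs are equal
    or far apart: a block that meets a reflection line is symmetric about it.
    The tiles of [u] are the octagons around the zero blocks, cut off by the
    rectangle (trapezoids and triangles come from the symmetric blocks), and the
    diamonds whose four vertices are ones.

    Conversely every coloured tile is a union of half unit squares with right
    angle at an uncoloured point, and the tiles cover each half square of the
    rectangle exactly once.  The function vanishing at the coloured points that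
    are interior to a tile or to a dashed side is then in the kernel, by
    inspection of the half squares at each uncoloured point. *)

(** * Reflection *)

(** The obstacle lies at the sides of the rectangle: [compat] sees only the part of a block inside
    it. The symmetry clauses of [valid] repair this, since a cut-off block can be folded back, so
    that in the extension its whole border consists of ones. Two zero blocks with a common point
    whose borders consist of ones contain each other, which makes the tile of a half square unique.
    Half squares are the right pieces because the diagonal sides of coloured tiles run through
    coloured points: no side cuts a half square, and a tile contains it or misses its interior.
    Covering and disjointness of polygons thus become integer statements. A region has several
    presentations as a [tile] (turns, shifts), while tilings are sets of regions. Each region is
    therefore described by its extreme values in the directions x, y, x + y and x - y. These are
    determined by the set, and they determine the colour and the dashed sides. *)

Section Fold.
Variable K : int.
Hypothesis K0 : 0 <= K.

(** The reflections in -1 and [K + 1] compose to the translation by [2 * (K + 2)], and [[-1, K + 1]]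
    is half a period. Adding 1 puts the lower mirror at residue 0. *)
Definition fold (x : int) : int :=
  let r := ((x + 1) %% (2 * (K + 2)))%Z in
  if r <= K + 2 then r - 1 else 2 * (K + 2) - r - 1.

Lemma fold_spec x : exists q : int, let A := q * (2 * (K + 2)) in
  -1 <= fold x <= K + 1 /\ (x = A + fold x \/ x = A - 2 - fold x).
Proof.
have Pn0 : 2 * (K + 2) != 0 :> int by lia.
have P0 : 0 < 2 * (K + 2) by lia.
have eq := divz_eq (x + 1) (2 * (K + 2)).
have r0 := modz_ge0 (x + 1) Pn0.
have r1 := ltz_pmod (x + 1) P0.
move: eq r0 r1; rewrite /fold.
set q := (_ %/ _)%Z; set r := (_ %% _)%Z => eq r0 r1.
case: ifP => rK; first by exists q; rewrite /=; split; lia.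
exists (q + 1); rewrite mulrDl /=; lia.
Qed.

Lemma fold_uniq (q x y : int) : let A := q * (2 * (K + 2)) in
  -1 <= y <= K + 1 -> x = A + y \/ x = A - 2 - y -> fold x = y.
Proof.
move=> A yK xA; have Pn0 : 2 * (K + 2) != 0 :> int by lia.
have modE (z : int) k : 0 <= z < 2 * (K + 2) ->
  ((k * (2 * (K + 2)) + z) %% (2 * (K + 2)))%Z = z.
  by move=> zP; rewrite modzMDl modz_small // gtr0_norm; lia.
case: xA => xA.
  have -> : fold x = fold (q * (2 * (K + 2)) + y) by rewrite xA.
  by rewrite /fold -addrA modE; [case: ifP; lia|lia].
have [y1|y1] := eqVneq y (-1).
  have e : x + 1 = q * (2 * (K + 2)) + 0 by lia.
  by rewrite /fold e modE; [case: ifP; lia|lia].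
have e : x + 1 = (q - 1) * (2 * (K + 2)) + (2 * (K + 2) - 1 - y).
  by rewrite mulrBl; lia.
by rewrite /fold e modE; [case: ifP; lia|lia].
Qed.

Lemma fold_id x : -1 <= x <= K + 1 -> fold x = x.
Proof. by move=> xK; apply: (@fold_uniq 0) => //; left; lia. Qed.

Lemma fold_reflect_lo x : fold (- 2 - x) = fold x.
Proof.
have [q /= [fK xq]] := fold_spec x.
by apply: (@fold_uniq (- q)) => //; rewrite mulNr; lia.
Qed.

Lemma fold_reflect_hi x : fold (2 * K + 2 - x) = fold x.
Proof.
have [q /= [fK xq]] := fold_spec x.
by apply: (@fold_uniq (1 - q)) => //; rewrite mulrBl; lia.
Qed.

(** Off the mirrors a kernel sum folds to a kernel sum, its terms at most swapped. On a mirror the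
    two neighbours across it fold to the same point, so their values cancel. *)
Lemma fold_step x : -1 <= fold x <= K + 1 /\
  (if (-1 < fold x < K + 1) then
    (fold (x + 1) = fold x + 1 /\ fold (x - 1) = fold x - 1) \/
    (fold (x + 1) = fold x - 1 /\ fold (x - 1) = fold x + 1)
  else fold (x + 1) = fold (x - 1)).
Proof.
have [q /= [fK xq]] := fold_spec x; split => //.
case: ifP => fx; last first.
  have [f1|f1] : fold x = -1 \/ fold x = K + 1 by lia.
    transitivity (0 : int); [|symmetry]; apply: (@fold_uniq q) => //; lia.
  transitivity K; [|symmetry]; case: xq => xq;
    [apply: (@fold_uniq (q + 1))|apply: (@fold_uniq q)
    |apply: (@fold_uniq q)|apply: (@fold_uniq (q - 1))];
    rewrite ?mulrDl ?mulrBl; lia.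
by case: xq => xq; [left|right]; split; apply: (@fold_uniq q) => //; lia.
Qed.

(** The reflections [- 2 - x] and [2 * K + 2 - x] keep parity, so folding maps coloured points to
    coloured points. *)
Lemma fold_even x : exists k : int, fold x = x + 2 * k.
Proof.
have [q /= [fK xq]] := fold_spec x.
case: xq => xq.
  exists (- (q * (K + 2))); rewrite {2}xq mulrCA; lia.
exists (q * (K + 2) - x - 1); move: xq; rewrite mulrCA; lia.
Qed.

End Fold.

(** * Vanishing cell sums and runs on the integers *)

Lemma int_step_ind (P : int -> Prop) :
  P 0 -> (forall i, P i <-> P (i + 1)) -> forall i, P i.
Proof.
move=> P0 PS; elim/int_ind => // n.
  by move/PS; rewrite -[n%:Z + 1]/(n%:Z + 1%:Z) -PoszD addn1.
move=> Pn; apply/PS; suff -> : - (n.+1)%:Z + 1 = - n%:Z by [].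
lia.
Qed.

(** The sum over a unit cell is a mixed second difference, so its vanishing separates the
    variables. *)
Lemma rectangle_rule_split (V : int -> int -> bool) :
  (forall i j, V i j (+) V (i + 1) (j + 1) (+) V (i + 1) j (+) V i (j + 1)
    = false) ->
  forall i j, V i j = V i 0 (+) V 0 j (+) V 0 0.
Proof.
move=> Vrule.
have Vcol i j : V i j (+) V i (j + 1) = V 0 j (+) V 0 (j + 1).
  elim/int_step_ind: i => // i; move: (Vrule i j).
  case: (V i j); case: (V (i + 1) j); case: (V i (j + 1));
  by case: (V (i + 1) (j + 1)); case: (V 0 j); case: (V 0 (j + 1)).
move=> i; elim/int_step_ind => [|j]; first by case: (V i 0); case: (V 0 0).
move: (Vcol i j); case: (V i j); case: (V i (j + 1));
by case: (V i 0); case: (V 0 0); case: (V 0 j); case: (V 0 (j + 1)).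
Qed.

Definition is_run (F : int -> bool) (a b : int) := [/\ a <= b,
  (forall k, a <= k <= b -> F k = F a), F (a - 1) <> F a & F (b + 1) <> F a].

Lemma periodicMn (F : int -> bool) (P : int) :
  (forall i, F (i + P) = F i) -> forall (k : nat) i, F (i + P * k) = F i.
Proof.
move=> FP; elim=> [|k IH] i; first by rewrite mulr0 addr0.
by rewrite -[RHS]IH -[RHS]FP; congr F; rewrite intS; lia.
Qed.

Lemma run_end (F : int -> bool) (i : int) :
  (exists n : nat, F (i + n) != F i) ->
  exists b, [/\ i <= b, (forall k, i <= k <= b -> F k = F i) &
    F (b + 1) <> F i].
Proof.
move=> ex; case: (ex_minnP ex) => n Fn nmin.
exists (i + n - 1); split.
- case: n Fn {nmin} => [|n] Fn; last by lia.
  by move: Fn; rewrite addr0 eqxx.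
- move=> k ik; apply/eqP/negP => /negP Fk.
  suff : (n <= `|k - i|)%N by lia.
  apply: nmin; suff -> : i + `|k - i|%N = k by [].
  lia.
- by rewrite addrNK; apply/eqP.
Qed.

Lemma run_exists (F : int -> bool) (P : int) : 0 < P ->
  (forall i, F (i + P) = F i) -> (exists k k', F k <> F k') ->
  forall i, exists a b, a <= i <= b /\ is_run F a b.
Proof.
move=> P0 FP [k0 [k1 Fk01]] i.
have [k Fk] : exists k, F k != F i.
  case: (eqVneq (F k0) (F i)) => [e|]; last by exists k0.
  by exists k1; apply/eqP; rewrite -e; apply/nesym.
have PM := periodicMn FP.
(* Since [P >= 1], [d] periods carry [k] past [i] on either side, so [F] changes both to the right
   and to the left of [i]. *)
pose d := absz (k - i)%R.
have leP : `|k - i| <= P * d.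
  by rewrite /d abszE -{1}[`|_|]mul1r ler_wpM2r //; lia.
have [b [ib bF Fb]] : exists b, [/\ i <= b, (forall k, i <= k <= b -> F k = F i)
    & F (b + 1) <> F i].
  apply: run_end; exists (absz (k + P * d - i)%R).
  suff -> : i + absz (k + P * d - i)%R = k + P * d by rewrite PM.
  lia.
(* The left end of the run is a right end for the reflected function. *)
pose F' x := F (- x).
have [b' [ib' bF' Fb']] : exists b, [/\ - i <= b,
    (forall k, - i <= k <= b -> F' k = F' (- i)) & F' (b + 1) <> F' (- i)].
  apply: run_end; exists (absz (- k + P * d + i)%R).
  suff -> : - i + absz (- k + P * d + i)%R = - (k - P * d).
    by rewrite /F' !opprK -(PM d (k - _)) subrK.
  lia.
have aF x : - b' <= x <= i -> F x = F i.
  move=> xb; have := bF' (- x); rewrite /F' !opprK; apply; lia.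
have Fa : F (- b') = F i by apply: aF; lia.
exists (- b'), b; split; first lia.
split=> [|x xb||].
- lia.
- by rewrite Fa; have [xi|xi] := lerP x i; [apply: aF|apply: bF]; lia.
- by rewrite Fa; move: Fb'; rewrite /F' opprK opprD.
- by rewrite Fa.
Qed.

(** Adjacent runs of equal value would merge, hence the distance 2. This extra unit leaves room for
    the squares of side 2, so that separated runs give a tile that does not cross the side. *)
Lemma run_cmp F a b a' b' : is_run F a b -> is_run F a' b' -> F a = F a' ->
  a = a' /\ b = b' \/ (b + 2 <= a') || (b' + 2 <= a).
Proof.
move=> [ab rF Fa Fb] [ab' rF' Fa' Fb'] e.
have [?|h1] := lerP (b + 2) a'; first by right.
have [?|h2] := lerP (b' + 2) a; first by right; apply/orP; right.
have bb : b' <= b.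
  by rewrite leNgt; apply/negP => lt; apply: Fb; rewrite e; apply: rF'; lia.
have bb' : b <= b'.
  by rewrite leNgt; apply/negP => lt; apply: Fb'; rewrite -e; apply: rF; lia.
have aa : a <= a'.
  by rewrite leNgt; apply/negP => lt; apply: Fa; rewrite e; apply: rF'; lia.
have aa' : a' <= a.
  by rewrite leNgt; apply/negP => lt; apply: Fa'; rewrite -e; apply: rF; lia.
by left; split; apply/le_anti/andP.
Qed.

(** * Extension of a kernel function to the whole lattice *)

Section Core.
Variables M N c : int.
Hypotheses (M1 : 1 <= M) (N1 : 1 <= N) (c01 : 0 <= c <= 1).

(* The coloured points are those with [x + y = c] modulo 2; [(i, j)] stands for
   the coloured point [x = i + j + c], [y = i - j], and also for the point of
   the other colour just to its right. *)
Definition lat (u : int -> int -> bool) i j := u (i + j + c) (i - j).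
Definition in_rect (x y : int) := (0 <= x <= M) && (0 <= y <= N).
Definition lat_rect i j := in_rect (i + j + c) (i - j).
Definition gap_rect i j := in_rect (i + j + 1 + c) (i - j).

Definition lat_kernel (v : int -> int -> bool) := forall i j, gap_rect i j ->
  v i j (+) v (i + 1) (j + 1) (+) v (i + 1) j (+) v i (j + 1) = false.

Lemma kernel_extension (u : int -> int -> bool) :
  (forall x y, u x y -> in_rect x y) -> lat_kernel (lat u) ->
  exists U : int -> int -> bool, [/\
    forall x y, in_rect x y -> U x y = u x y,
    (forall i j,
      lat U i j (+) lat U (i + 1) (j + 1) (+) lat U (i + 1) j
        (+) lat U i (j + 1) = false),
    (forall x y, U (- 2 - x) y = U x y /\ U (2 * M + 2 - x) y = U x y),
    (forall x y, U x (- 2 - y) = U x y /\ U x (2 * N + 2 - y) = U x y) &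
    (forall x y, [|| x == -1, x == M + 1, y == -1 | y == N + 1] ->
      U x y = false)].
Proof.
move=> usupp uker; have M0 : 0 <= M by lia. have N0 : 0 <= N by lia.
pose U x y := u (fold M x) (fold N y).
have U0 x y : [|| fold M x == -1, fold M x == M + 1, fold N y == -1
    | fold N y == N + 1] -> U x y = false.
  move=> h; apply/negP => /usupp; rewrite /in_rect; lia.
exists U; split.
- by move=> x y xy; rewrite /U !fold_id //; move: xy; rewrite /in_rect; lia.
- move=> i j; rewrite /lat.
  set x := i + j + 1 + c; set y := i - j.
  have -> : i + j + c = x - 1 by lia.
  have -> : i + 1 + (j + 1) + c = x + 1 by lia.
  have -> : i + 1 + j + c = x by lia.
  have -> : i + (j + 1) + c = x by lia.
  have -> : i + 1 - (j + 1) = y by lia.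
  have -> : i + 1 - j = y + 1 by lia.
  have -> : i - (j + 1) = y - 1 by lia.
  have [fx xstep] := fold_step M0 x; have [fy ystep] := fold_step N0 y.
  have [kx ex] := fold_even M0 x; have [ky ey] := fold_even N0 y.
  (* On a horizontal reflection line the horizontal neighbours vanish and the vertical ones agree.
     [Ux] is the same for vertical lines. *)
  have Uy : (-1 < fold N y < N + 1) = false ->
      U (x - 1) y (+) U (x + 1) y (+) U x (y + 1) (+) U x (y - 1) = false.
    move=> h; rewrite h in ystep.
    rewrite !(U0 _ y) /=; try by lia.
    by rewrite /U ystep addbb.
  have Ux : (-1 < fold M x < M + 1) = false ->
      U (x - 1) y (+) U (x + 1) y (+) U x (y + 1) (+) U x (y - 1) = false.
    move=> h; rewrite h in xstep.
    rewrite !(U0 x) /=; try by lia.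
    by rewrite /U xstep addbb.
  case hx: (-1 < fold M x < M + 1) xstep => xstep; last exact: Ux.
  case hy: (-1 < fold N y < N + 1) ystep => ystep; last exact: Uy.
  (* Folding moves x by [2 * kx] and y by [2 * ky], which shifts [(i, j)] by
     [(kx + ky, kx - ky)]. *)
  have := uker (i + kx + ky) (j + kx - ky); rewrite /gap_rect /in_rect /lat.
  have -> : i + kx + ky + (j + kx - ky) + 1 + c = fold M x by lia.
  have -> : i + kx + ky - (j + kx - ky) = fold N y by lia.
  have -> : i + kx + ky + (j + kx - ky) + c = fold M x - 1 by lia.
  have -> : i + kx + ky + 1 + (j + kx - ky + 1) + c = fold M x + 1 by lia.
  have -> : i + kx + ky + 1 - (j + kx - ky + 1) = fold N y by lia.
  have -> : i + kx + ky + 1 + (j + kx - ky) + c = fold M x by lia.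
  have -> : i + kx + ky + 1 - (j + kx - ky) = fold N y + 1 by lia.
  have -> : i + kx + ky + (j + kx - ky + 1) + c = fold M x by lia.
  have -> : i + kx + ky - (j + kx - ky + 1) = fold N y - 1 by lia.
  move/(_ ltac:(lia)); rewrite /U.
  case: xstep => -[-> ->]; case: ystep => -[-> ->];
  case: (u (_ - 1) _); case: (u (_ + 1) _); case: (u _ (_ + 1));
  by case: (u _ (_ - 1)).
- by move=> x y; rewrite /U fold_reflect_lo // fold_reflect_hi.
- by move=> x y; rewrite /U fold_reflect_lo // fold_reflect_hi.
- move=> x y h.
  have fix1 K z : 0 <= K -> z = -1 \/ z = K + 1 -> fold K z = z.
    by move=> K0 zK; apply: fold_id; lia.
  apply: U0; case/or4P: h => /eqP h.
  + by rewrite [fold M x]fix1 ?h ?eqxx //; auto.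
  + by rewrite [fold M x]fix1 ?h ?eqxx ?orbT //; auto.
  + by rewrite [fold N y]fix1 ?h ?eqxx ?orbT //; auto.
  + by rewrite [fold N y]fix1 ?h ?eqxx ?orbT //; auto.
Qed.

(** The zeros on y = -1, where [j = i + 1], express the part that depends on [j] by [F (j - 1)].
    Each of the other three lines then gives one symmetry of [F]: two reflections and the period
    [N + 2]. *)
Lemma kernel_extension_split (U : int -> int -> bool) :
  (forall i j, lat U i j (+) lat U (i + 1) (j + 1) (+) lat U (i + 1) j
        (+) lat U i (j + 1) = false) ->
  (forall x y, [|| x == -1, x == M + 1, y == -1 | y == N + 1] ->
      U x y = false) ->
  exists F : int -> bool, [/\ forall i j, lat U i j = F i (+) F (j - 1),
    forall i, F (- 2 - c - i) = F i, forall i, F (M - c - i) = F i &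
    forall i, F (i + (N + 2)) = F i].
Proof.
move=> /rectangle_rule_split Vsplit V0; pose F i := lat U i 0.
have VF i j : lat U i j = F i (+) F (j - 1).
  have : lat U (j - 1) j = false by apply: V0; lia.
  rewrite (Vsplit i) (Vsplit (j - 1)) /F.
  case: (lat U i 0); case: (lat U (j - 1) 0); case: (lat U 0 j);
  by case: (lat U 0 0).
have F0 i j : [|| i + j + c == -1, i + j + c == M + 1, i - j == -1
    | i - j == N + 1] -> F i = F (j - 1).
  by move/V0; rewrite -/(lat U i j) VF; case: (F i); case: (F _).
exists F; split=> // i.
- by rewrite (F0 i (- 1 - c - i)); [congr F|]; lia.
- by rewrite (F0 i (M + 1 - c - i)); [congr F|]; lia.
- by rewrite (F0 (i + (N + 2)) (i + 1)); [congr F|]; lia.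
Qed.

End Core.

(** * Tiles of a kernel function *)

(* [Dia i j] is the diamond around the uncoloured point [(i, j)].
   [Blk i0 i1 j0 j1] is the part inside the rectangle of the octagon spanned by
   the squares of side 2 centred at the coloured points of
   [[i0, i1] x [j0, j1]]; a square, hexagon or octagon when that octagon lies
   in the rectangle, a trapezoid or triangle otherwise. *)
Inductive ctile := Dia of int & int | Blk of int & int & int & int.

Definition in_blk i0 i1 j0 j1 (i j : int) : bool :=
  (i0 <= i <= i1) && (j0 <= j <= j1).

(** The corners of the surrounding frame are left out: there both [F i] and [F (j - 1)] differ from
    their values on the block, so their sum is zero again. *)
Definition blk_border (i0 i1 j0 j1 i j : int) : bool :=
  ((i == i0 - 1) || (i == i1 + 1)) && (j0 <= j <= j1)
  || (i0 <= i <= i1) && ((j == j0 - 1) || (j == j1 + 1)).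

(* The half unit square at the uncoloured point [(i, j)] towards its right
   ([e = 1]) or left ([e = 0]) and its upper ([f = 1]) or lower ([f = 0])
   neighbour. *)
Definition in_tile t (i j e f : int) : bool :=
  match t with
  | Dia k l => (i == k) && (j == l)
  | Blk i0 i1 j0 j1 =>
      [|| in_blk i0 i1 j0 j1 (i + e) (j + e),
          in_blk i0 i1 j0 j1 (i + f) (j + 1 - f)
        | in_blk i0 i1 j0 j1 (i + 1 - e) (j + 1 - e)
          && in_blk i0 i1 j0 j1 (i + 1 - f) (j + f)]
  end.

(** * Existence of the compatible tile at a half square *)

Section Core.
Variables M N c : int.
Hypotheses (M1 : 1 <= M) (N1 : 1 <= N) (c01 : 0 <= c <= 1).
Local Notation lat := (lat c).
Local Notation in_rect := (in_rect M N).
Local Notation lat_rect := (lat_rect M N c).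
Local Notation gap_rect := (gap_rect M N c).
Local Notation lat_kernel := (lat_kernel M N c).

Definition cell_rect (i j e f : int) := [&& 0 <= e <= 1, 0 <= f <= 1,
  gap_rect i j, lat_rect (i + e) (j + e) & lat_rect (i + f) (j + 1 - f)].

(* For each side of the rectangle, the octagon does not cross it, or it is
   symmetric about the parallel line at distance 1 outside. *)
Definition valid t : bool :=
  match t with
  | Dia i j => (1 <= i + j + 1 + c <= M - 1) && (1 <= i - j <= N - 1)
  | Blk i0 i1 j0 j1 => [&& i0 <= i1, j0 <= j1,
      (0 <= i0 - j1 - 1) || [&& j0 == i0 + 1, j1 == i1 + 1 & i0 < i1],
      (i1 - j0 + 1 <= N) ||
        [&& i0 == j0 + N + 1, i1 == j1 + N + 1 & i0 < i1],
      (0 <= i0 + j0 - 1 + c) ||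
        [&& j0 == - 1 - c - i1, j1 == - 1 - c - i0 & i0 < i1] &
      (i1 + j1 + 1 + c <= M) ||
        [&& j0 == M + 1 - c - i1, j1 == M + 1 - c - i0 & i0 < i1]]
  end.

(** Only the ones are guarded by [lat_rect]: a cut-off block has border points outside the
    rectangle, where a function supported in the rectangle is zero. *)
Definition compat (v : int -> int -> bool) t : Prop :=
  match t with
  | Dia i j => [&& v i j, v (i + 1) (j + 1), v (i + 1) j & v i (j + 1)]
  | Blk i0 i1 j0 j1 => forall i j,
      (in_blk i0 i1 j0 j1 i j -> ~~ v i j) /\
      (blk_border i0 i1 j0 j1 i j -> lat_rect i j -> v i j)
  end.

Lemma compat_tile_exists (u : int -> int -> bool) :
  (forall x y, u x y -> in_rect x y) -> lat_kernel (lat u) ->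
  (exists i j, lat u i j) ->
  forall i j e f, cell_rect i j e f ->
  exists t, [/\ valid t, compat (lat u) t & in_tile t i j e f].
Proof.
move=> usupp uker [iu [ju uij]] i j e f cell.
have [U [UE URule _ _ U0]] := kernel_extension M1 N1 c01 usupp uker.
have [F [VF Fl Fr FN]] := kernel_extension_split M1 N1 c01 URule U0.
have Fnc : exists k k', F k <> F k'.
  exists iu, (ju - 1) => Fe; have rij := usupp _ _ uij.
  by move: uij; rewrite /lat -UE // -/(lat U iu ju) VF Fe addbb.
have vE i' j' : in_rect (i' + j' + c) (i' - j') -> lat u i' j' = lat U i' j'.
  by move=> h; rewrite /lat UE.
have u_F i' j' : lat_rect i' j' -> lat u i' j' = F i' (+) F (j' - 1).
  by move=> h; rewrite vE // VF.
have u_out i' j' : ~~ lat_rect i' j' -> lat u i' j' = false.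
  by move=> h; apply/negP => /usupp; apply/negP.
have Nper : 0 < N + 2 by lia.
have runs := run_exists Nper FN Fnc.
(* The symmetries of [F] carry runs to runs. Comparing the two runs of a block after such a symmetry
   decides the clauses of [valid]. *)
have runL a b : is_run F a b -> is_run F (- 2 - c - b) (- 2 - c - a).
  move=> [ab rF Fa Fb]; split; first lia.
  - by move=> k ak; rewrite Fl -(Fl k) (rF (- 2 - c - k)) ?(rF b) //; lia.
  - have -> : - 2 - c - b - 1 = - 2 - c - (b + 1) by lia.
    by rewrite !Fl (rF b) //; lia.
  - have -> : - 2 - c - a + 1 = - 2 - c - (a - 1) by lia.
    by rewrite !Fl (rF b) //; lia.
have runR a b : is_run F a b -> is_run F (M - c - b) (M - c - a).
  move=> [ab rF Fa Fb]; split; first lia.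
  - by move=> k ak; rewrite Fr -(Fr k) (rF (M - c - k)) ?(rF b) //; lia.
  - have -> : M - c - b - 1 = M - c - (b + 1) by lia.
    by rewrite !Fr (rF b) //; lia.
  - have -> : M - c - a + 1 = M - c - (a - 1) by lia.
    by rewrite !Fr (rF b) //; lia.
have runN a b : is_run F a b -> is_run F (a + (N + 2)) (b + (N + 2)).
  move=> [ab rF Fa Fb]; split; first lia.
  - move=> k ak; have -> : k = k - (N + 2) + (N + 2) by lia.
    by rewrite !FN rF //; lia.
  - have -> : a + (N + 2) - 1 = a - 1 + (N + 2) by lia.
    by rewrite !FN.
  - have -> : b + (N + 2) + 1 = b + 1 + (N + 2) by lia.
    by rewrite !FN.
(* The block is the run of [p] times the run of [q - 1], the latter moved up by one. The point
   [(p, q)] may lie outside the rectangle. *)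
have block p q : F p = F (q - 1) -> exists i0 i1 j0 j1,
    [/\ in_blk i0 i1 j0 j1 p q,
      compat (lat u) (Blk i0 i1 j0 j1),
      (forall p' q', F p' = F (q' - 1) ->
        (p' = p /\ q - 1 <= q' <= q + 1) \/
        (q' = q /\ p - 1 <= p' <= p + 1) -> in_blk i0 i1 j0 j1 p' q') &
      in_tile (Blk i0 i1 j0 j1) i j e f -> valid (Blk i0 i1 j0 j1)].
  move=> Fpq.
  have [a [b [pab rab]]] := runs p; have [a' [b' [qab rab']]] := runs (q - 1).
  have [ab rF Fa Fb] := rab; have [ab' rF' Fa' Fb'] := rab'.
  have Faa : F a = F a' by rewrite -(rF p) // -(rF' (q - 1)).
  exists a, b, (a' + 1), (b' + 1); split.
  - by rewrite /in_blk pab; clear -qab; lia.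
  - move=> k l; split=> [|kl klR].
      rewrite /in_blk => /andP[kab lab].
      have [klR|/u_out -> //] := boolP (lat_rect k l).
      have lab' : a' <= l - 1 <= b' by clear -lab; lia.
      by rewrite u_F // (rF k kab) (rF' _ lab') Faa addbb.
    rewrite u_F //; have [[hk hl]|[hk hl]] : (k = a - 1 \/ k = b + 1)
      /\ a' <= l - 1 <= b' \/ a <= k <= b /\ (l - 1 = a' - 1 \/ l - 1 = b' + 1).
        by clear -kl; move: kl; rewrite /blk_border; lia.
      rewrite (rF' _ hl) -Faa; case: hk => ->; move: Fa Fb;
      by case: (F (a - 1)); case: (F (b + 1)); case: (F a).
    rewrite (rF _ hk) Faa; case: hl => ->; move: Fa' Fb';
    by case: (F (a' - 1)); case: (F (b' + 1)); case: (F a').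
  - have run_ext x y k : is_run F x y -> x <= k <= y -> forall k',
        k - 1 <= k' <= k + 1 -> F k' = F k -> x <= k' <= y.
      move=> [xy rxy Fx Fy] kxy k' kk'; rewrite (rxy k) //.
      have [->|nx] := eqVneq k' (x - 1); first by move/Fx.
      have [->|ny] := eqVneq k' (y + 1); first by move/Fy.
      by move=> _; clear -kk' nx ny kxy; lia.
    move=> p1 q1 F1 [[ep eq]|[eq ep]]; rewrite /in_blk.
      have : a' <= q1 - 1 <= b'.
        apply: (run_ext _ _ (q - 1)) => //; first by clear -eq; lia.
        by rewrite -F1 ep.
      by rewrite ep pab; clear; lia.
    have -> /= : a <= p1 <= b.
      by apply: (run_ext _ _ p) => //; rewrite F1 eq.
    by rewrite eq; clear -qab; lia.
  (* The comparison also allows a block beyond a reflection line, or a single point on it. Neither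
     reaches a half square of the rectangle, so [cell] and [cov] exclude both. *)
  - have cB := run_cmp rab rab' Faa.
    have cT := run_cmp rab (runN _ _ rab').
    rewrite FN in cT; have {}cT := cT Faa.
    have ab_b : a <= b <= b by rewrite ab /=.
    have cL := run_cmp rab' (runL _ _ rab).
    rewrite Fl (rF b ab_b) in cL; have {}cL := cL (esym Faa).
    have cR := run_cmp rab' (runR _ _ rab).
    rewrite Fr (rF b ab_b) in cR; have {}cR := cR (esym Faa).
    clear -M1 N1 c01 cell cB cT cL cR ab ab'.
    move: cell; rewrite /cell_rect /lat_rect /gap_rect /in_rect /in_tile /in_blk.
    move=> cell cov /=; rewrite ab /= lerD2r ab' /=; apply/and4P; split.
    + by clear cT cL cR; lia.
    + by clear cB cL cR; lia.
    + by clear cB cT cR; lia.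
    + by clear cB cT cL; lia.
have nbr k l : i <= k <= i + 1 -> j <= l <= j + 1 -> lat U k l ->
    lat_rect k l.
  move=> ki lj; apply: contraTT => klR; rewrite /lat U0 //; move: cell klR.
  clear -ki lj.
  by rewrite /cell_rect /lat_rect /gap_rect /in_rect; lia.
have e01 : e = 0 \/ e = 1 by clear -cell; move: cell; rewrite /cell_rect; lia.
have f01 : f = 0 \/ f = 1 by clear -cell; move: cell; rewrite /cell_rect; lia.
have zero k l : ~~ lat U k l -> F k = F (l - 1).
  by rewrite VF; case: (F k); case: (F _).
have one k l : lat U k l -> F k <> F (l - 1).
  by rewrite VF; case: (F k); case: (F _).
have [H1|/zero/block] := boolP (lat U (i + e) (j + e)); last first.
  move=> [i0 [i1 [j0 [j1 [b1 b2 _ b3]]]]]; exists (Blk i0 i1 j0 j1).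
  have inb : in_tile (Blk i0 i1 j0 j1) i j e f by rewrite /= b1.
  by split=> //; apply: b3.
have [V1|/zero/block] := boolP (lat U (i + f) (j + 1 - f)); last first.
  move=> [i0 [i1 [j0 [j1 [b1 b2 _ b3]]]]]; exists (Blk i0 i1 j0 j1).
  have inb : in_tile (Blk i0 i1 j0 j1) i j e f by rewrite /= b1 orbT.
  by split=> //; apply: b3.
(* The two near neighbours are ones, so by the cell rule the two far ones agree. *)
have HV : lat U (i + 1 - e) (j + 1 - e) = lat U (i + 1 - f) (j + f).
  move: (URule i j) H1 V1.
  by case: e01 => ->; case: f01 => ->; rewrite ?subr0 ?addrK ?addr0;
    case: (lat U i j); case: (lat U (i + 1) j); case: (lat U i (j + 1));
    case: (lat U (i + 1) (j + 1)).
have [H'1|H'0] := boolP (lat U (i + 1 - e) (j + 1 - e)); last first.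
  have /zero FV' : ~~ lat U (i + 1 - f) (j + f) by rewrite -HV.
  move: H'0 => /zero FH'; have := block _ _ FH'.
  move=> [i0 [i1 [j0 [j1 [b1 b2 bx b3]]]]]; exists (Blk i0 i1 j0 j1).
  (* The two far zeros share a coordinate and are one step apart in the other, so they lie in the
     same block. *)
  have b4 : in_blk i0 i1 j0 j1 (i + 1 - f) (j + f).
    by apply: (bx _ _ FV'); clear -e01 f01; lia.
  have inb : in_tile (Blk i0 i1 j0 j1) i j e f by rewrite /= b1 b4 !orbT.
  by split=> //; apply: b3.
have V'1 := H'1; rewrite HV in V'1.
have [A1 A2 A3 A4] : [/\ lat U i j, lat U (i + 1) (j + 1), lat U (i + 1) j
    & lat U i (j + 1)].
  move: H1 V1 H'1 V'1.
  by case: e01 => ->; case: f01 => ->; rewrite ?subr0 ?addrK ?addr0.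
have R1 : lat_rect i j by apply: nbr => //; clear; lia.
have R2 : lat_rect (i + 1) (j + 1) by apply: nbr => //; clear; lia.
have R3 : lat_rect (i + 1) j by apply: nbr => //; clear; lia.
have R4 : lat_rect i (j + 1) by apply: nbr => //; clear; lia.
exists (Dia i j); split.
- by clear -R1 R2 R3 R4; move: R1 R2 R3 R4; rewrite /lat_rect /in_rect /=; lia.
- by rewrite /= !vE // A1 A2 A3 A4.
- by rewrite /= !eqxx.
Qed.
End Core.

(** * Uniqueness of the compatible tile, and kernel functions from compatible covers *)

Lemma in_tile_corners i0 i1 j0 j1 i j e f : 0 <= e <= 1 -> 0 <= f <= 1 ->
  in_tile (Blk i0 i1 j0 j1) i j e f ->
  (in_blk i0 i1 j0 j1 (i + e) (j + e) ||
    blk_border i0 i1 j0 j1 (i + e) (j + e)) /\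
  (in_blk i0 i1 j0 j1 (i + f) (j + 1 - f) ||
    blk_border i0 i1 j0 j1 (i + f) (j + 1 - f)).
Proof.
move=> he hf.
have [->|->] : e = 0 \/ e = 1 by lia.
  have [->|->] : f = 0 \/ f = 1 by lia.
    by rewrite /in_tile /in_blk /blk_border; lia.
  by rewrite /in_tile /in_blk /blk_border; lia.
have [->|->] : f = 0 \/ f = 1 by lia.
  by rewrite /in_tile /in_blk /blk_border; lia.
by rewrite /in_tile /in_blk /blk_border; lia.
Qed.

(** If the second block exceeded the first, the way from [(p, q)] to the excess would pass a border
    point of the first, where [V] would be both one and zero. *)
Lemma blk_sub (V : int -> int -> bool) i0 i1 j0 j1 i0' i1' j0' j1' p q :
  (forall i j, blk_border i0 i1 j0 j1 i j -> V i j) ->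
  (forall i j, in_blk i0' i1' j0' j1' i j -> V i j = false) ->
  in_blk i0 i1 j0 j1 p q -> in_blk i0' i1' j0' j1' p q ->
  [/\ i0 <= i0', i1' <= i1, j0 <= j0' & j1' <= j1].
Proof.
move=> V1 V0; rewrite /in_blk => pq pq'.
have contra i j : blk_border i0 i1 j0 j1 i j -> in_blk i0' i1' j0' j1' i j ->
    False by move=> /V1 + /V0 => ->.
split; rewrite leNgt; apply/negP => lt.
- by apply: (contra (i0 - 1) q); rewrite /blk_border /in_blk; lia.
- by apply: (contra (i1 + 1) q); rewrite /blk_border /in_blk; lia.
- by apply: (contra p (j0 - 1)); rewrite /blk_border /in_blk; lia.
- by apply: (contra p (j1 + 1)); rewrite /blk_border /in_blk; lia.
Qed.

Section CoreTilings.
Variables M N c : int.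
Hypotheses (M1 : 1 <= M) (N1 : 1 <= N) (c01 : 0 <= c <= 1).
Local Notation lat := (lat c).
Local Notation in_rect := (in_rect M N).
Local Notation lat_rect := (lat_rect M N c).
Local Notation gap_rect := (gap_rect M N c).
Local Notation lat_kernel := (lat_kernel M N c).
Local Notation cell_rect := (cell_rect M N c).
Local Notation valid := (valid M N c).
Local Notation compat := (compat M N c).

(** A block that crosses a horizontal side is symmetric, so its points can be folded back without
    leaving the block or its border. [(j - 1, i + 1)] is the mirror image in y = -1 and
    [(j + (N + 1), i - (N + 1))] the one in y = N + 1. *)
Lemma reflect_vertical i0 i1 j0 j1 i j : valid (Blk i0 i1 j0 j1) ->
  in_blk i0 i1 j0 j1 i j || blk_border i0 i1 j0 j1 i j ->
  exists i' j', [/\ i' + j' = i + j,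
    i' - j' = i - j \/ i' - j' = - 2 - (i - j) \/ i' - j' = 2 * N + 2 - (i - j),
    in_blk i0 i1 j0 j1 i j = in_blk i0 i1 j0 j1 i' j',
    blk_border i0 i1 j0 j1 i j = blk_border i0 i1 j0 j1 i' j' &
    -1 <= i' - j' <= N + 1].
Proof.
rewrite /valid => /and5P[ii jj vB vT _]; rewrite /in_blk /blk_border => h.
have [y0|y0] := ltrP (i - j) 0; [|have [yN|yN] := ltrP N (i - j)].
- by exists (j - 1), (i + 1); split; lia.
- by exists (j + (N + 1)), (i - (N + 1)); split; lia.
- by exists i, j; split=> //; [left|lia].
Qed.

Lemma reflect_horizontal i0 i1 j0 j1 i j : valid (Blk i0 i1 j0 j1) ->
  in_blk i0 i1 j0 j1 i j || blk_border i0 i1 j0 j1 i j ->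
  exists i' j', [/\ i' - j' = i - j,
    i' + j' + c = i + j + c \/ i' + j' + c = - 2 - (i + j + c) \/
      i' + j' + c = 2 * M + 2 - (i + j + c),
    in_blk i0 i1 j0 j1 i j = in_blk i0 i1 j0 j1 i' j',
    blk_border i0 i1 j0 j1 i j = blk_border i0 i1 j0 j1 i' j' &
    -1 <= i' + j' + c <= M + 1].
Proof.
rewrite /valid => /and5P[ii jj _ _ /andP[vL vR]].
rewrite /in_blk /blk_border => h.
have [x0|x0] := ltrP (i + j + c) 0; [|have [xM|xM] := ltrP M (i + j + c)].
- by exists (- 1 - c - j), (- 1 - c - i); split; lia.
- by exists (M + 1 - c - j), (M + 1 - c - i); split; lia.
- by exists i, j; split=> //; [left|lia].
Qed.

(** In the coordinates [(i, j)] a symmetric block is a square with a diagonal on the reflection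
    line. The line leaves it through corners and so misses its border. The border of a block that is
    not symmetric about a line does not cross the corresponding side. *)
Lemma border_frame i0 i1 j0 j1 i j : valid (Blk i0 i1 j0 j1) ->
  blk_border i0 i1 j0 j1 i j -> -1 <= i - j <= N + 1 ->
  -1 <= i + j + c <= M + 1 -> lat_rect i j.
Proof.
rewrite /valid => /and5P[ii jj vB vT /andP[vL vR]].
rewrite /blk_border /lat_rect /in_rect => h y x; apply/andP; split.
  by clear vB vT; lia.
by clear vL vR; lia.
Qed.

(** In the extension the guard [lat_rect] disappears: a point is folded into the frame by a common
    symmetry of the block and of [U]. *)
Lemma compat_extension (u U : int -> int -> bool) i0 i1 j0 j1 :
  (forall x y, in_rect x y -> U x y = u x y) ->
  (forall x y, U (- 2 - x) y = U x y /\ U (2 * M + 2 - x) y = U x y) ->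
  (forall x y, U x (- 2 - y) = U x y /\ U x (2 * N + 2 - y) = U x y) ->
  (forall x y, [|| x == -1, x == M + 1, y == -1 | y == N + 1] ->
      U x y = false) ->
  valid (Blk i0 i1 j0 j1) -> compat (lat u) (Blk i0 i1 j0 j1) ->
  forall i j, (in_blk i0 i1 j0 j1 i j -> lat U i j = false) /\
    (blk_border i0 i1 j0 j1 i j -> lat U i j).
Proof.
move=> UE Ux Uy U0 vB cB i j.
case h : (in_blk i0 i1 j0 j1 i j || blk_border i0 i1 j0 j1 i j); last first.
  by move: h; case: in_blk; case: blk_border.
have [i' [j' [e1 e2 ein ebd y']]] := reflect_vertical vB h.
rewrite ein ebd in h *.
have [i'' [j'' [d1 d2 din dbd x'']]] := reflect_horizontal vB h.
rewrite din dbd; have -> : lat U i j = lat U i'' j''.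
  rewrite /lat; have [-> ->] : i'' - j'' = i' - j' /\ i + j = i' + j' by [].
  transitivity (U (i' + j' + c) (i' - j')).
    by case: e2 => [->|[->|->]] //; rewrite ?(Uy _ _).1 ?(Uy _ _).2.
  by case: d2 => [->|[->|->]] //; rewrite ?(Ux _ _).1 ?(Ux _ _).2.
rewrite -d1 in y'; split=> hB.
  have [r|r] := boolP (lat_rect i'' j'').
    by rewrite /lat UE //; apply/negbTE/(cB i'' j'').1.
  by rewrite /lat U0 //; move: r; clear -y' x''; rewrite /lat_rect /in_rect; lia.
have r := border_frame vB hB y' x''.
by rewrite /lat UE //; apply: (cB i'' j'').2.
Qed.

Lemma cell_rect01 i j e f : cell_rect i j e f -> 0 <= e <= 1 /\ 0 <= f <= 1.
Proof. by case/and5P. Qed.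

Lemma dia_blk_disjoint v k l i0 i1 j0 j1 i j e f : 0 <= e <= 1 -> 0 <= f <= 1 ->
  compat v (Dia k l) -> compat v (Blk i0 i1 j0 j1) ->
  in_tile (Dia k l) i j e f -> ~~ in_tile (Blk i0 i1 j0 j1) i j e f.
Proof.
move=> he hf /= /and4P[v1 v2 v3 v4] cB /andP[/eqP -> /eqP ->].
have nin p q : v p q -> in_blk i0 i1 j0 j1 p q = false.
  by move=> vpq; apply/negP => /((cB p q).1); rewrite vpq.
have [->|->] : e = 0 \/ e = 1 by clear -he; lia.
  have [->|->] : f = 0 \/ f = 1 by clear -hf; lia.
    by rewrite ?addr0 ?addrK ?subr0 ?nin.
  by rewrite ?addr0 ?addrK ?subr0 ?nin.
have [->|->] : f = 0 \/ f = 1 by clear -hf; lia.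
  by rewrite ?addr0 ?addrK ?subr0 ?nin.
by rewrite ?addr0 ?addrK ?subr0 ?nin.
Qed.

(** A near corner of the half square in one block cannot be on the border of the other. If no near
    corner is in a block, both blocks contain the far corners. Either way the blocks share a point,
    and [blk_sub] applies in both directions. *)
Lemma compat_tile_unique (u : int -> int -> bool) t t' i j e f :
  (forall x y, u x y -> in_rect x y) -> lat_kernel (lat u) ->
  valid t -> valid t' -> compat (lat u) t -> compat (lat u) t' ->
  cell_rect i j e f -> in_tile t i j e f -> in_tile t' i j e f -> t = t'.
Proof.
move=> usupp uker; have [U [UE _ Ux Uy U0]] := kernel_extension M1 N1 c01 usupp uker.
move=> vt vt' ct ct' /cell_rect01[he hf].
case: t t' vt vt' ct ct' => [k l|i0 i1 j0 j1] [k' l'|i0' i1' j0' j1'] vt vt' ct ct'.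
- by move=> /andP[/eqP -> /eqP ->] /andP[/eqP -> /eqP ->].
- by move=> /(dia_blk_disjoint he hf ct ct')/negP.
- by move=> + /(dia_blk_disjoint he hf ct' ct)/negP.
move=> it it'.
have G := compat_extension UE Ux Uy U0 vt ct.
have G' := compat_extension UE Ux Uy U0 vt' ct'.
have [h1 h2] := in_tile_corners he hf it.
have [h1' h2'] := in_tile_corners he hf it'.
have [p [q [pq pq']]] : exists p q, in_blk i0 i1 j0 j1 p q /\
    in_blk i0' i1' j0' j1' p q.
  case H : (in_blk i0 i1 j0 j1 (i + e) (j + e)) in h1 it.
    exists (i + e), (j + e); split=> //.
    by case/orP: h1' => // /((G' _ _).2); rewrite (G _ _).1.
  case V : (in_blk i0 i1 j0 j1 (i + f) (j + 1 - f)) in h2 it.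
    exists (i + f), (j + 1 - f); split=> //.
    by case/orP: h2' => // /((G' _ _).2); rewrite (G _ _).1.
  exists (i + 1 - e), (j + 1 - e); move: it; rewrite /= H V /= => /andP[-> _].
  case: (boolP (in_blk i0' i1' j0' j1' (i + e) (j + e))) => [/((G' _ _).1)|H'].
    by rewrite (G _ _).2.
  case: (boolP (in_blk i0' i1' j0' j1' (i + f) (j + 1 - f))).
    by move=> /((G' _ _).1); rewrite (G _ _).2.
  by move=> V'; move: it'; rewrite /= (negbTE H') (negbTE V') /= => /andP[-> _].
have [a1 a2 a3 a4] := blk_sub (fun i j => (G i j).2) (fun i j => (G' i j).1) pq pq'.
have [b1 b2 b3 b4] := blk_sub (fun i j => (G' i j).2) (fun i j => (G i j).1) pq' pq.
by congr Blk; apply/le_anti/andP.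
Qed.

(** A block that covers a half square contains four, two adjacent or one of the neighbours of its
    right angle. The other neighbours are border points, hence ones, except the one opposite to a
    single corner. Only there is a second tile consulted. *)
Lemma kernel_of_compat_cover (u : int -> int -> bool) :
  (forall x y, u x y -> in_rect x y) ->
  (forall i j e f, cell_rect i j e f ->
    exists t, [/\ valid t, compat (lat u) t & in_tile t i j e f]) ->
  lat_kernel (lat u).
Proof.
move=> usupp cov i j w.
have u_out k l : ~~ lat_rect k l -> lat u k l = false.
  by move=> h; apply/negP => /usupp; apply/negP.
have corner k l : i <= k <= i + 1 -> j <= l <= j + 1 ->
    -1 <= k - l <= N + 1 /\ -1 <= k + l + c <= M + 1.
  by move=> hk hl; clear -w hk hl; move: w; rewrite /gap_rect /in_rect; lia.
have [e [f cell]] : exists e f, cell_rect i j e f.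
  (* The half square points left and down, except on the left or bottom side, where it is turned
     inwards. *)
  exists (if i + j + 1 + c <= 0 then 1 else 0), (if i - j <= 0 then 1 else 0).
  clear -w M1 N1; move: w; rewrite /cell_rect /gap_rect /lat_rect /in_rect.
  by case: ifP; case: ifP; lia.
have [[k l|i0 i1 j0 j1] [vt ct it]] := cov _ _ _ _ cell.
  by move: ct it => /= /and4P[A1 A2 A3 A4] /andP[/eqP -> /eqP ->]; rewrite A1 A2 A3 A4.
have cZ := fun k l => (ct k l).1.
have cB k l : i <= k <= i + 1 -> j <= l <= j + 1 ->
    blk_border i0 i1 j0 j1 k l -> lat u k l /\ lat_rect k l.
  move=> hk hl hb; have [hy hx] := corner k l hk hl.
  by have r := border_frame vt hb hy hx; split=> //; apply: (ct k l).2.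
(* A single corner [(p, q)] of the block at [(i, j)]: the opposite corner is a
   zero too, because the half squares there lie in some other block. *)
have single p q e' f' : p = i \/ p = i + 1 -> q = j \/ q = j + 1 ->
    in_blk i0 i1 j0 j1 p q ->
    blk_border i0 i1 j0 j1 p (2 * j + 1 - q) ->
    blk_border i0 i1 j0 j1 (2 * i + 1 - p) q ->
    0 <= e' <= 1 -> 0 <= f' <= 1 ->
    i + e' = 2 * i + 1 - p /\ j + e' = 2 * j + 1 - q \/
      i + f' = 2 * i + 1 - p /\ j + 1 - f' = 2 * j + 1 - q ->
    ~~ lat u (2 * i + 1 - p) (2 * j + 1 - q).
  move=> hp hq zpq b1 b2 he' hf' opp.
  have [r|/u_out -> //] := boolP (lat_rect (2 * i + 1 - p) (2 * j + 1 - q)).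
  have [v1 r1] : lat u p (2 * j + 1 - q) /\ lat_rect p (2 * j + 1 - q).
    by apply: cB => //; clear -hp hq; lia.
  have [v2 r2] : lat u (2 * i + 1 - p) q /\ lat_rect (2 * i + 1 - p) q.
    by apply: cB => //; clear -hp hq; lia.
  have cell' : cell_rect i j e' f'.
    clear -w he' hf' hp hq opp r r1 r2.
    move: w r r1 r2; rewrite /cell_rect /gap_rect /lat_rect /in_rect; lia.
  have [t' [vt' ct' it']] := cov _ _ _ _ cell'.
  case: t' vt' ct' it' => [k l|i0' i1' j0' j1'] vt' ct' it'.
    move: (cZ _ _ zpq) ct' it' => + /= /and4P[A1 A2 A3 A4] /andP[/eqP ei /eqP ej].
    by rewrite -ei -ej in A1 A2 A3 A4; case: hp hq => -> [] ->;
      rewrite ?A1 ?A2 ?A3 ?A4.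
  apply: (ct' _ _).1.
  have n1 : in_blk i0' i1' j0' j1' p (2 * j + 1 - q) = false.
    by apply/negP => /((ct' _ _).1); rewrite v1.
  have n2 : in_blk i0' i1' j0' j1' (2 * i + 1 - p) q = false.
    by apply/negP => /((ct' _ _).1); rewrite v2.
  clear -he' hf' hp hq opp it' n1 n2.
  have e01 : e' = 0 \/ e' = 1 by lia.
  have f01 : f' = 0 \/ f' = 1 by lia.
  move: opp it' n1 n2; rewrite /in_tile /in_blk; clear he' hf'.
  by case: hp hq e01 f01 => -> [] -> [] -> [] ->; lia.
have [he hf] := cell_rect01 cell.
have e01 : e = 0 \/ e = 1 by clear -he; lia.
have f01 : f = 0 \/ f = 1 by clear -hf; lia.
have single4 : [/\ in_blk i0 i1 j0 j1 i j -> blk_border i0 i1 j0 j1 i (j + 1) ->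
      blk_border i0 i1 j0 j1 (i + 1) j -> lat u (i + 1) (j + 1) = false,
    in_blk i0 i1 j0 j1 (i + 1) (j + 1) -> blk_border i0 i1 j0 j1 i (j + 1) ->
      blk_border i0 i1 j0 j1 (i + 1) j -> lat u i j = false,
    in_blk i0 i1 j0 j1 i (j + 1) -> blk_border i0 i1 j0 j1 i j ->
      blk_border i0 i1 j0 j1 (i + 1) (j + 1) -> lat u (i + 1) j = false &
    in_blk i0 i1 j0 j1 (i + 1) j -> blk_border i0 i1 j0 j1 i j ->
      blk_border i0 i1 j0 j1 (i + 1) (j + 1) -> lat u i (j + 1) = false].
  have two (x : int) : 2 * x + 1 - x = x + 1 by lia.
  have two' (x : int) : 2 * x + 1 - (x + 1) = x by lia.
  (* One parameter turns the half square towards the opposite neighbour; the other is kept from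
     [cell]. *)
  have c1 := single i j 1 f; have c2 := single (i + 1) (j + 1) 0 f.
  have c3 := single i (j + 1) e 1; have c4 := single (i + 1) j e 0.
  rewrite !two ?two' in c1 c2 c3 c4.
  split=> h1 h2 h3; apply/negbTE.
  - by apply: c1 => //; clear; lia.
  - by apply: c2 => //; clear; lia.
  - by apply: c3 => //; clear; lia.
  - by apply: c4 => //; clear; lia.
have Zs k l : in_blk i0 i1 j0 j1 k l -> lat u k l = false.
  by move=> /cZ/negbTE.
have Bs k l : i <= k <= i + 1 -> j <= l <= j + 1 ->
    blk_border i0 i1 j0 j1 k l -> lat u k l.
  by move=> hk hl /(cB _ _ hk hl)[].
have {cB} Bs : [/\ blk_border i0 i1 j0 j1 i j -> lat u i j,
    blk_border i0 i1 j0 j1 (i + 1) (j + 1) -> lat u (i + 1) (j + 1),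
    blk_border i0 i1 j0 j1 (i + 1) j -> lat u (i + 1) j &
    blk_border i0 i1 j0 j1 i (j + 1) -> lat u i (j + 1)].
  by split; apply: Bs; clear; lia.
have {Zs} Zs := And4 (Zs i j) (Zs (i + 1) (j + 1)) (Zs (i + 1) j) (Zs i (j + 1)).
have [ii jj] : i0 <= i1 /\ j0 <= j1 by move: vt => /and5P[].
clear single cov usupp u_out ct cZ vt cell w corner he hf.
move: single4 Zs Bs it; rewrite /in_tile /in_blk /blk_border.
move: (lat u i j) (lat u (i + 1) j) (lat u i (j + 1)) (lat u (i + 1) (j + 1)).
(* Values with even sum are immediate; an odd sum contradicts the position of the block among the
   four neighbours. *)
case=> [] [] [] [] // [s1 s2 s3 s4] [z1 z2 z3 z4] [b1 b2 b3 b4] it; exfalso;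
case: e01 it => ->; case: f01 => -> it; lia.
Qed.
End CoreTilings.

(** * From an exact cover to a kernel function *)

Section Exact.
Variables M N c : int.
Hypotheses (M1 : 1 <= M) (N1 : 1 <= N) (c01 : 0 <= c <= 1).
Local Notation lat := (lat c).
Local Notation in_rect := (in_rect M N).
Local Notation lat_rect := (lat_rect M N c).
Local Notation gap_rect := (gap_rect M N c).
Local Notation lat_kernel := (lat_kernel M N c).
Local Notation cell_rect := (cell_rect M N c).
Local Notation valid := (valid M N c).
Local Notation compat := (compat M N c).

Definition tile_zero t (i j : int) : bool :=
  if t is Blk i0 i1 j0 j1 then in_blk i0 i1 j0 j1 i j else false.

(** The source of injectivity: with [point_cell], the tiles determine the function at every coloured
    point. *)
Lemma compat_value v t i j e f : compat v t -> cell_rect i j e f ->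
  in_tile t i j e f -> v (i + e) (j + e) = ~~ tile_zero t (i + e) (j + e).
Proof.
move=> ct cell; have [he hf] := cell_rect01 cell.
have e01 : e = 0 \/ e = 1 by clear -he; lia.
have r : lat_rect (i + e) (j + e) by case/and5P: cell.
case: t ct => [k l|i0 i1 j0 j1] ct it.
  move: ct it => /= /and4P[A1 A2 A3 A4] /andP[/eqP -> /eqP ->].
  by case: e01 => ->; rewrite ?addr0.
have [+ _] := in_tile_corners he hf it; rewrite /tile_zero.
by case: (boolP (in_blk _ _ _ _ _ _)) => [/((ct _ _).1)/negbTE|_ /((ct _ _).2) ->].
Qed.

Lemma point_cell i j : lat_rect i j ->
  exists k l e f, [/\ cell_rect k l e f, k + e = i & l + e = j].
Proof.
move=> r; have [xM|xM] := ltrP (i + j + c) M.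
  exists i, j, 0, (if i - j < N then 1 else 0); rewrite !addr0; split=> //.
  move: r; rewrite /cell_rect /gap_rect /lat_rect /in_rect; case: ifP; lia.
exists (i - 1), (j - 1), 1, (if i - j < N then 1 else 0).
rewrite !subrK; split=> //.
move: r; rewrite /cell_rect /gap_rect /lat_rect /in_rect; case: ifP; lia.
Qed.

Lemma border_cell i0 i1 j0 j1 p q : valid (Blk i0 i1 j0 j1) ->
  blk_border i0 i1 j0 j1 p q -> lat_rect p q ->
  exists i j e f, [/\ cell_rect i j e f, in_tile (Blk i0 i1 j0 j1) i j e f &
    i + e = p /\ j + e = q \/ i + f = p /\ j + 1 - f = q].
Proof.
move=> /and5P[ii jj vB vT /andP[vL vR]] bd.
rewrite /lat_rect /in_rect => r.
have fin i j e f : cell_rect i j e f -> in_tile (Blk i0 i1 j0 j1) i j e f ->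
    i + e = p /\ j + e = q \/ i + f = p /\ j + 1 - f = q ->
    exists i j e f, [/\ cell_rect i j e f, in_tile (Blk i0 i1 j0 j1) i j e f &
    i + e = p /\ j + e = q \/ i + f = p /\ j + 1 - f = q].
  by move=> *; exists i, j, e, f.
(* The half square is next to the neighbour [(k, l)] of [(p, q)] in the block
   if that lies in the rectangle, and along the dashed side otherwise. *)
have inside k l : lat_rect k l || ~~ lat_rect k l by case: lat_rect.
rewrite /cell_rect /gap_rect /lat_rect /in_rect /in_tile /in_blk in fin inside *.
have [[e1 e2]|[[e1 e2]|[[e1 e2]|[e1 e2]]]] :
  p = i0 - 1 /\ j0 <= q <= j1 \/ p = i1 + 1 /\ j0 <= q <= j1 \/
  q = j0 - 1 /\ i0 <= p <= i1 \/ q = j1 + 1 /\ i0 <= p <= i1.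
  by clear -bd; move: bd; rewrite /blk_border; lia.
- clear bd; case/orP: (inside i0 q) => z.
    by apply: (fin p q 0 1); clear fin inside; lia.
  have [yN|yN] := eqVneq (p - q) N.
    by apply: (fin p q 0 0); clear fin inside vB; lia.
  by apply: (fin p (q - 1) 0 0); clear fin inside vL; lia.
- clear bd; case/orP: (inside i1 q) => z.
    by apply: (fin (p - 1) (q - 1) 1 0); clear fin inside; lia.
  have [y0|y0] := eqVneq (p - q) 0.
    by apply: (fin (p - 1) (q - 1) 1 1); clear fin inside vT; lia.
  by apply: (fin (p - 1) q 1 1); clear fin inside vR; lia.
- clear bd; case/orP: (inside p j0) => z.
    by apply: (fin p q 0 0); clear fin inside; lia.
  have [y0|y0] := eqVneq (p - q) 0.
    by apply: (fin p q 0 1); clear fin inside vT; lia.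
  by apply: (fin (p - 1) q 0 1); clear fin inside vL; lia.
clear bd; case/orP: (inside p j1) => z.
  by apply: (fin (p - 1) (q - 1) 1 1); clear fin inside; lia.
have [yN|yN] := eqVneq (p - q) N.
  by apply: (fin (p - 1) (q - 1) 1 0); clear fin inside vB; lia.
by apply: (fin p (q - 1) 1 0); clear fin inside vR; lia.
Qed.

(** This makes the function of a tiling nonzero: any border point, folded into the frame, lies in
    the rectangle by [border_frame]. *)
Lemma border_nonempty i0 i1 j0 j1 : valid (Blk i0 i1 j0 j1) ->
  exists p q, blk_border i0 i1 j0 j1 p q /\ lat_rect p q.
Proof.
move=> vB; have [ii jj] : i0 <= i1 /\ j0 <= j1 by case/and5P: vB.
have b : blk_border i0 i1 j0 j1 (i1 + 1) j0.
  by rewrite /blk_border eqxx orbT lexx jj.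
have ob : in_blk i0 i1 j0 j1 (i1 + 1) j0 || blk_border i0 i1 j0 j1 (i1 + 1) j0.
  by rewrite b orbT.
have [i' [j' [_ _ _ eb y]]] := reflect_vertical M1 N1 c01 vB ob.
rewrite eb in b.
have ob' : in_blk i0 i1 j0 j1 i' j' || blk_border i0 i1 j0 j1 i' j'.
  by rewrite b orbT.
have [i'' [j'' [e _ _ eb' x]]] := reflect_horizontal M1 N1 c01 vB ob'.
rewrite eb' in b; exists i'', j''; split=> //.
by apply: (border_frame M1 N1 c01 vB b _ x); rewrite e.
Qed.

Lemma kernel_of_exact_cover (T : ctile -> Prop) :
  (forall t, T t -> valid t) ->
  (forall i j e f, cell_rect i j e f -> exists2 t, T t & in_tile t i j e f) ->
  (forall t t' i j e f, T t -> T t' -> cell_rect i j e f ->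
    in_tile t i j e f -> in_tile t' i j e f -> t = t') ->
  exists u : int -> int -> bool, [/\ forall x y, u x y -> in_rect x y,
    lat_kernel (lat u), exists i j, lat u i j & forall t, T t -> compat (lat u) t].
Proof.
move=> vT covT uniqT.
pose z i j := `[< exists2 t, T t & tile_zero t i j >].
(* The quotients are the coordinates [(i, j)], exact at coloured points. *)
pose u x y := in_rect x y &&
  ~~ z ((x + y - c) %/ 2)%Z ((x - y - c) %/ 2)%Z.
have uE i j : lat u i j = lat_rect i j && ~~ z i j.
  by rewrite /lat /u; congr (_ && ~~ z _ _); lia.
have usupp x y : u x y -> in_rect x y by case/andP.
(* A half square with an end in a block belongs to the tile of that block. So a tile that puts a
   zero at an end of a half square of [t] is [t] itself, and no other tile spoils the ones that [t]
   requires. *)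
have zero_cell t t' i j e f p q : T t -> T t' -> cell_rect i j e f ->
    in_tile t i j e f -> i + e = p /\ j + e = q \/ i + f = p /\ j + 1 - f = q ->
    tile_zero t' p q -> t = t'.
  move=> Tt Tt' cell it hpq; case: t' Tt' => // i0 i1 j0 j1 Tt' zt'.
  apply: (uniqT _ _ _ _ _ _ Tt Tt' cell it).
  by case: hpq zt' => -[<- <-] /= ->; rewrite ?orbT.
have compT t : T t -> compat (lat u) t.
  move=> Tt; have := vT _ Tt; case: t Tt => [k l|i0 i1 j0 j1] Tt vt.
    have one p q e f : cell_rect k l e f ->
        k + e = p /\ l + e = q \/ k + f = p /\ l + 1 - f = q -> lat u p q.
      move=> cell hpq; rewrite uE; apply/andP; split.
        by case/and5P: cell; case: hpq => -[<- <-].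
      apply/negP => /asboolP[t' Tt' zt'].
      have it : in_tile (Dia k l) k l e f by rewrite /= !eqxx.
      by move: (zt'); rewrite -(zero_cell _ _ _ _ _ _ _ _ Tt Tt' cell it hpq zt').
    have cell e f : 0 <= e <= 1 -> 0 <= f <= 1 -> cell_rect k l e f.
      move=> he hf; move: vt; clear -he hf.
      by rewrite /valid /cell_rect /gap_rect /lat_rect /in_rect; lia.
    apply/and4P; split.
    + by apply: (one _ _ 0 0); [apply: cell|left; clear; lia].
    + by apply: (one _ _ 1 0); [apply: cell|left; clear; lia].
    + by apply: (one _ _ 0 1); [apply: cell|right; clear; lia].
    + by apply: (one _ _ 0 0); [apply: cell|right; clear; lia].
  move=> p q; split=> [zpq|bpq rpq]; rewrite uE.
    suff -> : z p q by rewrite andbF.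
    by apply/asboolP; exists (Blk i0 i1 j0 j1).
  rewrite rpq /=; apply/negP => /asboolP[t' Tt' zt'].
  have [i [j [e [f [cell it hpq]]]]] := border_cell vt bpq rpq.
  move: (zt'); rewrite -(zero_cell _ _ _ _ _ _ _ _ Tt Tt' cell it hpq zt') /=.
  by move: bpq; clear; rewrite /blk_border /in_blk; lia.
exists u; split=> //.
  apply: (kernel_of_compat_cover M1 N1 c01) => // i j e f cell.
  have [t Tt it] := covT _ _ _ _ cell.
  by exists t; split; [apply: vT|apply: compT|].
have r0 : lat_rect 0 0 by rewrite /lat_rect /in_rect; lia.
have [k [l [e [f [cell _ _]]]]] := point_cell r0.
have [t Tt it] := covT _ _ _ _ cell.
have := compT _ Tt; have := vT _ Tt; case: t {Tt it} => [i j|i0 i1 j0 j1] vt.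
  by move=> /and4P[? _ _ _]; exists i, j.
have [p [q [b r]]] := border_nonempty vt.
by move=> ct; exists p, q; apply: (ct p q).2.
Qed.
End Exact.

(** * Polygons *)

Local Open Scope classical_set_scope.

Section ConvexHull.
Context {R : realType}.
Implicit Types (p v : R * R) (vs : seq (R * R)).

(** Coefficients on all of [nat] do not depend on the length of the list, so they survive [map]. *)
Lemma conv_hullP vs p : conv_hull vs p <-> exists c : nat -> R,
  [/\ forall i, (i < size vs)%N -> 0 <= c i, \sum_(i < size vs) c i = 1,
    p.1 = \sum_(i < size vs) c i * (vs`_i).1 &
    p.2 = \sum_(i < size vs) c i * (vs`_i).2].
Proof.
split=> [[c [c0 c1 px py]]|[c [c0 c1 px py]]]; last first.
  by exists (fun i => c i); split=> // i; apply: c0.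
pose c' k := if insub k is Some i then c i else 0.
have c'E (i : 'I_(size vs)) : c' i = c i by rewrite /c' valK.
exists c'; split.
- by move=> i lt; rewrite -[i]/(val (Ordinal lt)) c'E.
- by rewrite -[RHS]c1; apply: eq_bigr => i _; rewrite c'E.
- by rewrite px; apply: eq_bigr => i _; rewrite c'E.
- by rewrite py; apply: eq_bigr => i _; rewrite c'E.
Qed.

Lemma conv_hull_vertex vs v : v \in vs -> conv_hull vs v.
Proof.
move=> vvs; apply/conv_hullP; exists (fun k => (k == index v vs)%:R).
have lt : (index v vs < size vs)%N by rewrite index_mem.
have sumE (F : nat -> R) :
    \sum_(i < size vs) (val i == index v vs)%:R * F i = F (index v vs).
  rewrite (bigD1 (Ordinal lt)) //= eqxx mul1r big1 ?addr0 // => i ni.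
  suff -> : (val i == index v vs) = false by rewrite mul0r.
  by apply: contraNF ni => /eqP e; apply/eqP/val_inj.
split.
- by move=> i _; apply: ler0n.
- by rewrite -[RHS](sumE (fun=> 1)); apply: eq_bigr => i _; rewrite mulr1.
- by rewrite (sumE (fun i => (vs`_i).1)) nth_index.
- by rewrite (sumE (fun i => (vs`_i).2)) nth_index.
Qed.

Lemma conv_hull_convex vs p q l : conv_hull vs p -> conv_hull vs q ->
  0 <= l <= 1 ->
  conv_hull vs ((1 - l) * p.1 + l * q.1, (1 - l) * p.2 + l * q.2).
Proof.
move=> /conv_hullP[c [c0 c1 px py]] /conv_hullP[d [d0 d1 qx qy]] /andP[l0 l1].
apply/conv_hullP; exists (fun i => (1 - l) * c i + l * d i); split.
- by move=> i lt; rewrite addr_ge0 // mulr_ge0 ?c0 ?d0 // subr_ge0.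
- by rewrite big_split -!mulr_sumr /= c1 d1; ring.
- rewrite px qx !mulr_sumr -big_split /=; apply: eq_bigr => i _; ring.
- rewrite py qy !mulr_sumr -big_split /=; apply: eq_bigr => i _; ring.
Qed.

Lemma conv_hull_le vs (a b k : R) p :
  (forall v, v \in vs -> a * v.1 + b * v.2 <= k) -> conv_hull vs p ->
  a * p.1 + b * p.2 <= k.
Proof.
move=> vk /conv_hullP[c [c0 c1 -> ->]].
rewrite !mulr_sumr -big_split /= -[k]mul1r -c1 mulr_suml.
apply: ler_sum => i _.
have -> : a * (c i * (vs`_i).1) + b * (c i * (vs`_i).2) =
  c i * (a * (vs`_i).1 + b * (vs`_i).2) by ring.
by rewrite ler_wpM2l ?c0 // vk // mem_nth.
Qed.

Lemma conv_hull_affine vs (f : R * R -> R * R) a b k a' b' k' :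
  (forall p, f p = (a * p.1 + b * p.2 + k, a' * p.1 + b' * p.2 + k')) ->
  conv_hull (map f vs) = f @` conv_hull vs.
Proof.
move=> fE; have sumE (c : nat -> R) (x y z : R) :
    \sum_(i < size vs) c i = 1 ->
    \sum_(i < size vs) c i * (x * (vs`_i).1 + y * (vs`_i).2 + z) =
    x * (\sum_(i < size vs) c i * (vs`_i).1)
    + y * (\sum_(i < size vs) c i * (vs`_i).2) + z.
  move=> c1; rewrite -[z in RHS]mul1r -{1}c1 mulr_suml !mulr_sumr -!big_split /=.
  by apply: eq_bigr => i _; ring.
apply/seteqP; split=> [q /conv_hullP[c]|_ [p /conv_hullP[c [c0 c1 px py]] <-]].
  rewrite size_map => -[c0 c1 qx qy].
  exists (\sum_(i < size vs) c i * (vs`_i).1, \sum_(i < size vs) c i * (vs`_i).2).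
    by apply/conv_hullP; exists c.
  rewrite fE /= -!sumE // [q]surjective_pairing qx qy.
  by congr pair; apply: eq_bigr => i _; rewrite (nth_map 0) // fE.
apply/conv_hullP; exists c; rewrite size_map; split=> //.
  rewrite fE /= px py -sumE //; apply: eq_bigr => i _.
  by rewrite (nth_map 0) // fE.
rewrite fE /= px py -sumE //; apply: eq_bigr => i _.
by rewrite (nth_map 0) // fE.
Qed.

Lemma conv_hull_row vs (x x1 x2 y : R) : conv_hull vs (x1, y) ->
  conv_hull vs (x2, y) -> x1 <= x <= x2 -> conv_hull vs (x, y).
Proof.
move=> h1 h2 /andP[le1 le2].
have [e|ne] := eqVneq x1 x2.
  by have -> : x = x1 by apply/le_anti; rewrite le1 e le2.
have x12 : 0 < x2 - x1 by rewrite subr_gt0 lt_neqAle ne (le_trans le1 le2).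
have := @conv_hull_convex vs _ _ ((x - x1) / (x2 - x1)) h1 h2.
have -> : ((1 - (x - x1) / (x2 - x1)) * (x1, y).1
    + (x - x1) / (x2 - x1) * (x2, y).1,
   (1 - (x - x1) / (x2 - x1)) * (x1, y).2
    + (x - x1) / (x2 - x1) * (x2, y).2) = (x, y).
  by congr pair; rewrite /=; field; rewrite gt_eqF.
apply; rewrite divr_ge0 ?(ltW x12) ?subr_ge0 //=.
by rewrite ler_pdivrMr // mul1r lerB.
Qed.

(* The point at height [k] of a side of horizontal slope [d] and height [l]. *)
Lemma conv_hull_side vs (x y d l k : R) : conv_hull vs (x, y) ->
  conv_hull vs (x + d * l, y + l) -> 0 <= k <= l ->
  conv_hull vs (x + d * k, y + k).
Proof.
move=> h1 h2 /andP[k0 kl].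
have [l0|l0] := eqVneq l 0.
  by have -> : k = l by apply/le_anti; rewrite kl l0.
have lp : 0 < l by rewrite lt_neqAle eq_sym l0 (le_trans k0 kl).
have := @conv_hull_convex vs _ _ (k / l) h1 h2.
have -> : ((1 - k / l) * (x, y).1 + k / l * (x + d * l, y + l).1,
   (1 - k / l) * (x, y).2 + k / l * (x + d * l, y + l).2)
   = (x + d * k, y + k).
  by congr pair; rewrite /=; field.
by apply; rewrite divr_ge0 ?(ltW lp) //= ler_pdivrMr // mul1r.
Qed.

End ConvexHull.

(** * Polygons cut out by bounds in eight directions *)

Record bounds (T : Type) := Bounds
  { xlo : T; xhi : T; ylo : T; yhi : T; slo : T; shi : T; tlo : T; thi : T }.

Definition map_bounds (T T' : Type) (f : T -> T') (b : bounds T) :=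
  Bounds (f (xlo b)) (f (xhi b)) (f (ylo b)) (f (yhi b))
    (f (slo b)) (f (shi b)) (f (tlo b)) (f (thi b)).

Definition turn_bounds (T : zmodType) (b : bounds T) :=
  Bounds (- yhi b) (- ylo b) (xlo b) (xhi b)
    (tlo b) (thi b) (- shi b) (- slo b).

Definition shift_bounds (T : zmodType) (x y : T) (b : bounds T) :=
  Bounds (xlo b + x) (xhi b + x) (ylo b + y) (yhi b + y)
    (slo b + (x + y)) (shi b + (x + y)) (tlo b + (x - y)) (thi b + (x - y)).

(** Every entry is an attained extreme value, also in directions where the tile has no side;
    otherwise the bounds of a region would not be unique. *)
Definition proto_bounds (T : comNzRingType) (s : prototile) : bounds T :=
  match s with
  | Square => Bounds 0 2 0 2 0 4 (- 2) 2
  | Diamond => Bounds (-1) 1 0 2 0 2 (- 2) 0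
  | Octagon a b => Bounds (- b%:R) (2 + a%:R) 0 (a%:R + b%:R + 2)
      0 (2 * a%:R + 4) (- 2 * b%:R - 2) 2
  | Hexagon a => Bounds (- a%:R) 2 0 (2 + a%:R) 0 4 (- 2 * a%:R - 2) 2
  | Trapezoid a => Bounds 0 (2 * a%:R + 2) 0 a%:R
      0 (2 * a%:R + 2) 0 (2 * a%:R + 2)
  | Triangle a => Bounds 0 a%:R 0 a%:R 0 a%:R (- a%:R) a%:R
  end.

Section Region.
Context {R : realType}.

Definition region (b : bounds R) : set (R * R) :=
  [set p | [/\ xlo b <= p.1 <= xhi b, ylo b <= p.2 <= yhi b,
    slo b <= p.1 + p.2 <= shi b & tlo b <= p.1 - p.2 <= thi b]].

Lemma conv_hull_region vs b : (forall v, v \in vs -> region b v) ->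
  conv_hull vs `<=` region b.
Proof.
move=> vb p hp.
have le := conv_hull_le (vs := vs) (p := p).
have x1 := le (-1) 0 (- xlo b); have x2 := le 1 0 (xhi b).
have y1 := le 0 (-1) (- ylo b); have y2 := le 0 1 (yhi b).
have s1 := le (-1) (-1) (- slo b); have s2 := le 1 1 (shi b).
have t1 := le (-1) 1 (- tlo b); have t2 := le 1 (-1) (thi b).
split; apply/andP; split.
- suff : -1 * p.1 + 0 * p.2 <= - xlo b by lra.
  by apply: x1 => // v /vb [*]; lra.
- suff : 1 * p.1 + 0 * p.2 <= xhi b by lra.
  by apply: x2 => // v /vb [*]; lra.
- suff : 0 * p.1 + -1 * p.2 <= - ylo b by lra.
  by apply: y1 => // v /vb [*]; lra.
- suff : 0 * p.1 + 1 * p.2 <= yhi b by lra.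
  by apply: y2 => // v /vb [*]; lra.
- suff : -1 * p.1 + -1 * p.2 <= - slo b by lra.
  by apply: s1 => // v /vb [*]; lra.
- suff : 1 * p.1 + 1 * p.2 <= shi b by lra.
  by apply: s2 => // v /vb [*]; lra.
- suff : -1 * p.1 + 1 * p.2 <= - tlo b by lra.
  by apply: t1 => // v /vb [*]; lra.
- suff : 1 * p.1 + -1 * p.2 <= thi b by lra.
  by apply: t2 => // v /vb [*]; lra.
Qed.

(** The values [a = 0] and [b = 0] give squares and hexagons. Vertices then coincide, so [vs] is
    only required to contain the eight points. The row through the point ends on one of three sides
    to the left and one of three to the right. *)
Lemma octagon_conv_hull vs (a b : R) : 0 <= a -> 0 <= b ->
  {subset [:: (0, 0); (2, 0); (2 + a, a); (2 + a, a + 2);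
      (2 + a - b, a + b + 2); (a - b, a + b + 2); (- b, b + 2); (- b, b)]
    <= vs} ->
  region (Bounds (- b) (2 + a) 0 (a + b + 2)
      0 (2 * a + 4) (- 2 * b - 2) 2) `<=` conv_hull vs.
Proof.
move=> a0 b0 sub [x y] [/= x1 y1 s1 t1].
have vert v : v \in [:: (0, 0); (2, 0); (2 + a, a); (2 + a, a + 2);
      (2 + a - b, a + b + 2); (a - b, a + b + 2); (- b, b + 2); (- b, b)] ->
    conv_hull vs v.
  by move=> /sub/conv_hull_vertex.
have left : exists2 x', conv_hull vs (x', y) & x' <= x.
  have [yb|yb] := lerP y b.
    exists (0 + -1 * y); [|lra].
    have -> : (0 + -1 * y, y) = (0 + -1 * y, 0 + y) by congr pair; ring.
    apply: (conv_hull_side (l := b)).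
    - by apply: vert; rewrite !inE eqxx.
    - by rewrite mulN1r !add0r; apply: vert; rewrite !inE eqxx !orbT.
    - lra.
  have [yb'|yb'] := lerP y (b + 2).
    exists (- b + 0 * (y - b)); [|lra].
    have -> : (- b + 0 * (y - b), y) = (- b + 0 * (y - b), b + (y - b)).
      by congr pair; ring.
    apply: (conv_hull_side (l := 2)).
    - by apply: vert; rewrite !inE eqxx !orbT.
    - by rewrite mul0r addr0; apply: vert; rewrite !inE eqxx !orbT.
    - lra.
  exists (- b + 1 * (y - (b + 2))); [|lra].
  have -> : (- b + 1 * (y - (b + 2)), y) =
      (- b + 1 * (y - (b + 2)), b + 2 + (y - (b + 2))) by congr pair; ring.
  apply: (conv_hull_side (l := a)).
  - by apply: vert; rewrite !inE eqxx !orbT.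
  - have -> : (- b + 1 * a, b + 2 + a) = (a - b, a + b + 2).
      by congr pair; ring.
    by apply: vert; rewrite !inE eqxx !orbT.
  - lra.
have right : exists2 x', conv_hull vs (x', y) & x <= x'.
  have [ya|ya] := lerP y a.
    exists (2 + 1 * y); [|lra].
    have -> : (2 + 1 * y, y) = (2 + 1 * y, 0 + y) by congr pair; ring.
    apply: (conv_hull_side (l := a)).
    - by apply: vert; rewrite !inE eqxx !orbT.
    - by rewrite mul1r !add0r; apply: vert; rewrite !inE eqxx !orbT.
    - lra.
  have [ya'|ya'] := lerP y (a + 2).
    exists (2 + a + 0 * (y - a)); [|lra].
    have -> : (2 + a + 0 * (y - a), y) = (2 + a + 0 * (y - a), a + (y - a)).
      by congr pair; ring.
    apply: (conv_hull_side (l := 2)).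
    - by apply: vert; rewrite !inE eqxx !orbT.
    - by rewrite mul0r addr0; apply: vert; rewrite !inE eqxx !orbT.
    - lra.
  exists (2 + a + -1 * (y - (a + 2))); [|lra].
  have -> : (2 + a + -1 * (y - (a + 2)), y) =
      (2 + a + -1 * (y - (a + 2)), a + 2 + (y - (a + 2))) by congr pair; ring.
  apply: (conv_hull_side (l := b)).
  - by apply: vert; rewrite !inE eqxx !orbT.
  - have -> : (2 + a + -1 * b, a + 2 + b) = (2 + a - b, a + b + 2).
      by congr pair; ring.
    by apply: vert; rewrite !inE eqxx !orbT.
  - lra.
have [x' hx' lx'] := left; have [x'' hx'' lx''] := right.
by apply: (conv_hull_row hx' hx''); rewrite lx'.
Qed.

Lemma conv_hull_proto s : proto_ok s ->
  conv_hull (proto_vertices s) = region (proto_bounds R s).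
Proof.
move=> ok; apply/seteqP; split.
  apply: conv_hull_region => v.
  have nat0 (a : nat) : 0 <= a%:R :> R by apply: ler0n.
  case: s ok => [||a b|a|a|a] /= ok; rewrite !inE;
  rewrite ?(orbA, orbF) => h; repeat (case/orP: h => h); move/eqP: h => ->;
  rewrite /region /=;
  (try have a0 := nat0 a); (try have b0 := nat0 b); split; lra.
case: s ok => [||a b|a|a|a] /= ok.
- have := @octagon_conv_hull (proto_vertices Square) 0 0 (lexx _) (lexx _).
  rewrite !(addr0, oppr0, mulr0, add0r, subr0); apply=> v.
  by rewrite !inE; do ?(case/orP); move=> /eqP ->; rewrite eqxx ?orbT.
- move=> [x y] [/= x1 y1 s1 t1].
  set vs := [:: _; _; _; _].
  have v0 : conv_hull vs (0, 0) by apply: conv_hull_vertex; rewrite !inE eqxx.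
  have v1 : conv_hull vs (1, 1).
    by apply: conv_hull_vertex; rewrite !inE eqxx ?orbT.
  have v2 : conv_hull vs (0, 2).
    by apply: conv_hull_vertex; rewrite !inE eqxx ?orbT.
  have v3 : conv_hull vs (-1, 1).
    by apply: conv_hull_vertex; rewrite !inE eqxx ?orbT.
  have [yb|yb] := lerP y 1.
    apply: (@conv_hull_row _ _ x (0 + -1 * y) (0 + 1 * y)); last lra.
      have -> : (0 + -1 * y, y) = (0 + -1 * y, 0 + y) by congr pair; ring.
      apply: (conv_hull_side (l := 1)) => //; [|lra].
      by rewrite mulr1 !add0r.
    have -> : (0 + 1 * y, y) = (0 + 1 * y, 0 + y) by congr pair; ring.
    apply: (conv_hull_side (l := 1)) => //; [|lra].
    by rewrite mulr1 !add0r.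
  apply: (@conv_hull_row _ _ x (-1 + 1 * (y - 1)) (1 + -1 * (y - 1))); last lra.
    have -> : (-1 + 1 * (y - 1), y) = (-1 + 1 * (y - 1), 1 + (y - 1)).
      by congr pair; ring.
    apply: (conv_hull_side (l := 1)) => //; [|lra].
    by have -> : (-1 + 1 * 1, 1 + 1) = (0, 2) :> R * R by congr pair; ring.
  have -> : (1 + -1 * (y - 1), y) = (1 + -1 * (y - 1), 1 + (y - 1)).
    by congr pair; ring.
  apply: (conv_hull_side (l := 1)) => //; [|lra].
  by have -> : (1 + -1 * 1, 1 + 1) = (0, 2) :> R * R by congr pair; ring.
- exact: octagon_conv_hull.
- have := @octagon_conv_hull (proto_vertices (Hexagon a)) 0 a%:R (lexx _) (ler0n _ _).
  rewrite !(addr0, oppr0, mulr0, add0r, sub0r) [a%:R + 2]addrC; apply=> v.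
  by rewrite !inE; do ?(case/orP); move=> /eqP ->; rewrite eqxx ?orbT.
- move=> [x y] [/= x1 y1 s1 t1]; set vs := [:: _; _; _; _].
  have v0 : conv_hull vs (0, 0) by apply: conv_hull_vertex; rewrite !inE eqxx.
  have v1 : conv_hull vs (2 * a%:R + 2, 0).
    by apply: conv_hull_vertex; rewrite !inE eqxx ?orbT.
  apply: (@conv_hull_row _ _ x (0 + 1 * y) (2 * a%:R + 2 + -1 * y)); last lra.
    have -> : (0 + 1 * y, y) = (0 + 1 * y, 0 + y) by congr pair; ring.
    apply: (conv_hull_side (l := a%:R)) => //.
    by rewrite mul1r !add0r; apply: conv_hull_vertex; rewrite !inE eqxx ?orbT.
  have -> : (2 * a%:R + 2 + -1 * y, y) = (2 * a%:R + 2 + -1 * y, 0 + y).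
    by congr pair; ring.
  apply: (conv_hull_side (l := a%:R)) => //.
  have -> : (2 * a%:R + 2 + -1 * a%:R, 0 + a%:R) = (a%:R + 2, a%:R) :> R * R.
    by congr pair; ring.
  by apply: conv_hull_vertex; rewrite !inE eqxx ?orbT.
- move=> [x y] [/= x1 y1 s1 t1]; set vs := [:: _; _; _].
  have v0 : conv_hull vs (0, 0) by apply: conv_hull_vertex; rewrite !inE eqxx.
  have v1 : conv_hull vs (a%:R, 0).
    by apply: conv_hull_vertex; rewrite !inE eqxx ?orbT.
  have v2 : conv_hull vs (0, a%:R).
    by apply: conv_hull_vertex; rewrite !inE eqxx ?orbT.
  apply: (@conv_hull_row _ _ x (0 + 0 * y) (a%:R + -1 * y)); last lra.
    have -> : (0 + 0 * y, y) = (0 + 0 * y, 0 + y) by congr pair; ring.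
    apply: (conv_hull_side (l := a%:R)) => //.
    by rewrite mul0r !add0r.
  have -> : (a%:R + -1 * y, y) = (a%:R + -1 * y, 0 + y) by congr pair; ring.
  apply: (conv_hull_side (l := a%:R)) => //.
  by have -> : (a%:R + -1 * a%:R, 0 + a%:R) = (0, a%:R) :> R * R by congr pair; ring.
Qed.

Definition tile_bounds (t : tile (R := R)) : bounds R :=
  shift_bounds (tile_shift t).1 (tile_shift t).2
    (iter (tile_turns t) (@turn_bounds R) (proto_bounds R (tile_proto t))).

Lemma conv_hull_turn k vs b : conv_hull vs = region b ->
  conv_hull [seq iter k quarter_turn v | v <- vs] =
  region (iter k (@turn_bounds R) b).
Proof.
elim: k => [|k IH] vsb /=; first by rewrite map_id.
have -> : [seq quarter_turn (iter k quarter_turn v) | v <- vs] =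
    map quarter_turn [seq iter k quarter_turn v | v <- vs] by rewrite -map_comp.
rewrite (@conv_hull_affine _ _ _ 0 (-1) 0 1 0 0).
  rewrite IH //; apply/seteqP; split.
    by move=> _ [q [/= h1 h2 h3 h4] <-]; split=> /=; lra.
  move=> q [/= h1 h2 h3 h4]; exists (q.2, - q.1).
    by split=> /=; lra.
  by rewrite /quarter_turn /= opprK; case: q {h1 h2 h3 h4}.
by move=> p; rewrite /quarter_turn; congr pair; ring.
Qed.

Lemma tile_regionE t : tile_region t = region (tile_bounds t).
Proof.
have ok := tile_ok t; have := conv_hull_turn (tile_turns t) (conv_hull_proto ok).
rewrite /tile_region /tile_bounds; set vs := [seq _ | _ <- _] => e.
have -> : [seq place t v | v <- proto_vertices (tile_proto t)] =
    [seq (p.1 + (tile_shift t).1, p.2 + (tile_shift t).2) | p <- vs].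
  by rewrite -map_comp.
rewrite (@conv_hull_affine _ _ _ 1 0 (tile_shift t).1 0 1 (tile_shift t).2).
  rewrite e; apply/seteqP; split.
    by move=> _ [q [/= h1 h2 h3 h4] <-]; split=> /=; lra.
  move=> q [/= h1 h2 h3 h4].
  exists (q.1 - (tile_shift t).1, q.2 - (tile_shift t).2).
    by split=> /=; lra.
  by rewrite /= !subrK; case: q {h1 h2 h3 h4}.
by move=> p; congr pair; ring.
Qed.

Definition attained (b : bounds R) (f : R * R -> R) (v : R) : Prop :=
  exists2 p, region b p & f p = v.

(** Attained bounds are the extreme values of the functionals on the region, so the set determines
    them ([region_inj]). *)
Record tight (b : bounds R) : Prop := Tight {
  tight_xlo : attained b fst (xlo b);
  tight_xhi : attained b fst (xhi b);
  tight_ylo : attained b snd (ylo b);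
  tight_yhi : attained b snd (yhi b);
  tight_slo : attained b (fun p => p.1 + p.2) (slo b);
  tight_shi : attained b (fun p => p.1 + p.2) (shi b);
  tight_tlo : attained b (fun p => p.1 - p.2) (tlo b);
  tight_thi : attained b (fun p => p.1 - p.2) (thi b) }.

Lemma proto_tight s : proto_ok s -> tight (proto_bounds R s).
Proof.
have nat0 (a : nat) : 0 <= a%:R :> R by apply: ler0n.
case: s => [||a b|a|a|a] _; (try have a0 := nat0 a); (try have b0 := nat0 b).
- split; [exists (0, 0)|exists (2, 0)|exists (0, 0)|exists (0, 2)
    |exists (0, 0)|exists (2, 2)|exists (0, 2)|exists (2, 0)];
    try split; rewrite /=; lra.
- split; [exists (-1, 1)|exists (1, 1)|exists (0, 0)|exists (0, 2)
    |exists (0, 0)|exists (1, 1)|exists (0, 2)|exists (0, 0)];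
    try split; rewrite /=; lra.
- split; [exists (- b%:R, b%:R)|exists (2 + a%:R, a%:R)|exists (0, 0)
    |exists (a%:R - b%:R, a%:R + b%:R + 2)
    |exists (0, 0)|exists (2 + a%:R, a%:R + 2)|exists (- b%:R, b%:R + 2)
    |exists (2, 0)]; try split; rewrite /=; lra.
- split; [exists (- a%:R, a%:R)|exists (2, 0)|exists (0, 0)
    |exists (- a%:R, 2 + a%:R)
    |exists (0, 0)|exists (2, 2)|exists (- a%:R, 2 + a%:R)
    |exists (2, 0)]; try split; rewrite /=; lra.
- split; [exists (0, 0)|exists (2 * a%:R + 2, 0)|exists (0, 0)
    |exists (a%:R, a%:R)
    |exists (0, 0)|exists (2 * a%:R + 2, 0)|exists (0, 0)
    |exists (2 * a%:R + 2, 0)]; try split; rewrite /=; lra.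
- split; [exists (0, 0)|exists (a%:R, 0)|exists (0, 0)|exists (0, a%:R)
    |exists (0, 0)|exists (a%:R, 0)|exists (0, a%:R)|exists (a%:R, 0)];
    try split; rewrite /=; lra.
Qed.

Lemma turn_tight b : tight b -> tight (turn_bounds b).
Proof.
move=> [[p1 r1 e1] [p2 r2 e2] [p3 r3 e3] [p4 r4 e4]
  [p5 r5 e5] [p6 r6 e6] [p7 r7 e7] [p8 r8 e8]].
have turnr p : region b p -> region (turn_bounds b) (quarter_turn p).
  by move=> [h1 h2 h3 h4]; split=> /=; lra.
split.
- by exists (quarter_turn p4); [apply: turnr|rewrite /= e4].
- by exists (quarter_turn p3); [apply: turnr|rewrite /= e3].
- by exists (quarter_turn p1); [apply: turnr|rewrite /= e1].
- by exists (quarter_turn p2); [apply: turnr|rewrite /= e2].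
- by exists (quarter_turn p7); [apply: turnr|rewrite /= -e7; lra].
- by exists (quarter_turn p8); [apply: turnr|rewrite /= -e8; lra].
- by exists (quarter_turn p6); [apply: turnr|rewrite /= -e6; lra].
- by exists (quarter_turn p5); [apply: turnr|rewrite /= -e5; lra].
Qed.

Lemma shift_tight x y b : tight b -> tight (shift_bounds x y b).
Proof.
move=> [[p1 r1 e1] [p2 r2 e2] [p3 r3 e3] [p4 r4 e4]
  [p5 r5 e5] [p6 r6 e6] [p7 r7 e7] [p8 r8 e8]].
pose sh (p : R * R) : R * R := (p.1 + x, p.2 + y).
have shr p : region b p -> region (shift_bounds x y b) (sh p).
  by move=> [h1 h2 h3 h4]; split=> /=; lra.
split.
- by exists (sh p1); [apply: shr|rewrite /= e1].
- by exists (sh p2); [apply: shr|rewrite /= e2].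
- by exists (sh p3); [apply: shr|rewrite /= e3].
- by exists (sh p4); [apply: shr|rewrite /= e4].
- by exists (sh p5); [apply: shr|rewrite /= -e5; lra].
- by exists (sh p6); [apply: shr|rewrite /= -e6; lra].
- by exists (sh p7); [apply: shr|rewrite /= -e7; lra].
- by exists (sh p8); [apply: shr|rewrite /= -e8; lra].
Qed.

Lemma tile_tight t : tight (tile_bounds t).
Proof.
apply: shift_tight; elim: (tile_turns t) => [|k IH] /=.
  exact: proto_tight (tile_ok t).
exact: turn_tight.
Qed.

Lemma region_inj b b' : tight b -> tight b' -> region b = region b' -> b = b'.
Proof.
have le b1 b2 : tight b1 -> region b1 `<=` region b2 ->
    [/\ xlo b2 <= xlo b1, xhi b1 <= xhi b2, ylo b2 <= ylo b1
      & yhi b1 <= yhi b2] /\ [/\ slo b2 <= slo b1, shi b1 <= shi b2, tlo b2 <= tlo b1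
      & thi b1 <= thi b2].
  move=> [[p1 r1 e1] [p2 r2 e2] [p3 r3 e3] [p4 r4 e4]
    [p5 r5 e5] [p6 r6 e6] [p7 r7 e7] [p8 r8 e8]] sub.
  split; split.
  - by case: (sub _ r1) => *; lra.
  - by case: (sub _ r2) => *; lra.
  - by case: (sub _ r3) => *; lra.
  - by case: (sub _ r4) => *; lra.
  - by case: (sub _ r5) => *; lra.
  - by case: (sub _ r6) => *; lra.
  - by case: (sub _ r7) => *; lra.
  - by case: (sub _ r8) => *; lra.
move=> tb tb' e.
have := le _ _ tb; rewrite e => /(_ _ (subset_refl (A := _))).
have := le _ _ tb'; rewrite -e => /(_ _ (subset_refl (A := _))).
case: b b' {tb tb' e} => [? ? ? ? ? ? ? ?] [? ? ? ? ? ? ? ?] /=.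
move=> [[h1 h2 h3 h4] [h5 h6 h7 h8]] [[k1 k2 k3 k4] [k5 k6 k7 k8]].
by congr Bounds; apply/le_anti/andP; split.
Qed.

End Region.

(** * Integral tiles *)

Definition code_bounds (s : prototile) (k : nat) (x y : int) : bounds int :=
  shift_bounds x y (iter k (@turn_bounds int) (proto_bounds int s)).

Lemma turn_bounds4 (T : zmodType) k (b : bounds T) :
  iter k (@turn_bounds T) b = iter (k %% 4) (@turn_bounds T) b.
Proof.
have turn4 b' : iter 4 (@turn_bounds T) b' = b'.
  by case: b' => *; rewrite /= /turn_bounds /= !opprK.
rewrite {1}(divn_eq k 4) addnC iterD; congr (iter _ _ _).
elim: (k %/ 4)%N => // n IH; by rewrite mulSn iterD IH turn4.
Qed.

(** For tight bounds equality means that this corner of the bounding box lies in the tile: a point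
    where x + y is minimal then has minimal x and minimal y. *)
Definition corner_bl (b : bounds int) := slo b == xlo b + ylo b.
Definition corner_br (b : bounds int) := thi b == xhi b - ylo b.
Definition corner_tl (b : bounds int) := tlo b == xlo b - yhi b.
Definition corner_tr (b : bounds int) := shi b == xhi b + yhi b.
Definition box (b : bounds int) :=
  [&& corner_bl b, corner_br b, corner_tl b & corner_tr b].

(* Among all tiles, a side of the bounding box is a dashed side of the tile iff
   the tile reaches both its corners and is not a square. *)
Definition dash_bottom b := [&& corner_bl b, corner_br b & ~~ box b].
Definition dash_top b := [&& corner_tl b, corner_tr b & ~~ box b].
Definition dash_left b := [&& corner_bl b, corner_tl b & ~~ box b].
Definition dash_right b := [&& corner_br b, corner_tr b & ~~ box b].

(* A number of the parity of [x + y] at the vertices that determine the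
   colour: for a triangle, an end point of its hypotenuse. *)
Definition colour_bound (b : bounds int) : int :=
  if shi b - slo b < thi b - tlo b then tlo b else slo b.

Definition dash_ok (M N : int) (b : bounds int) : bool :=
  [&& dash_bottom b ==> (ylo b == 0), dash_top b ==> (yhi b == N),
    dash_left b ==> (xlo b == 0) & dash_right b ==> (xhi b == M)].

Definition int_turn (p : int * int) : int * int := (- p.2, p.1).
Definition int_place k (x y : int) p : int * int :=
  let q := iter k int_turn p in (q.1 + x, q.2 + y).

Definition int_vertices (s : prototile) : seq (int * int) :=
  match s with
  | Square => [:: (0, 0); (2, 0); (2, 2); (0, 2)]
  | Diamond => [:: (0, 0); (1, 1); (0, 2); (-1, 1)]
  | Octagon a' b' => let a : int := a'%:R in let b : int := b'%:R in
      [:: (0, 0); (2, 0); (2 + a, a); (2 + a, a + 2);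
          (2 + a - b, a + b + 2); (a - b, a + b + 2); (- b, b + 2); (- b, b)]
  | Hexagon a' => let a : int := a'%:R in
      [:: (0, 0); (2, 0); (2, 2); (2 - a, 2 + a); (- a, 2 + a); (- a, a)]
  | Trapezoid a' => let a : int := a'%:R in
      [:: (0, 0); (2 * a + 2, 0); (a + 2, a); (a, a)]
  | Triangle a' => let a : int := a'%:R in
      [:: (0, 0); (a, 0); (0, a)]
  end.

Definition int_colour_vertices (s : prototile) : seq (int * int) :=
  if s is Triangle _ then behead (int_vertices s) else int_vertices s.

Definition int_dashed (s : prototile) : seq ((int * int) * (int * int)) :=
  match s with
  | Trapezoid a' => let a : int := a'%:R in [:: ((0, 0), (2 * a + 2, 0))]
  | Triangle a' => let a : int := a'%:R in
      [:: ((0, 0), (a, 0)); ((0, 0), (0, a))]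
  | _ => [::]
  end.

Lemma colour_boundP s k x y p : proto_ok s -> (k < 4)%N ->
  p \in int_colour_vertices s ->
  (2 %| (int_place k x y p).1 + (int_place k x y p).2
    - colour_bound (code_bounds s k x y))%Z.
Proof.
case: p => px py.
case: s => [||a b|a|a|a] /= ok; case: k => [|[|[|[|k]]]] //= _; rewrite ?inE;
rewrite ?(orbA, orbF) => h; repeat (case/orP: h => h); move/eqP: h => [-> ->];
rewrite /colour_bound /=; case: ifP; lia.
Qed.

Lemma dashedP s k x y e : proto_ok s -> (k < 4)%N -> e \in int_dashed s ->
  let b := code_bounds s k x y in
  let p := int_place k x y e.1 in let q := int_place k x y e.2 in
  [\/ dash_bottom b /\ p.2 = ylo b /\ q.2 = ylo b,
      dash_top b /\ p.2 = yhi b /\ q.2 = yhi b,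
      dash_left b /\ p.1 = xlo b /\ q.1 = xlo b |
      dash_right b /\ p.1 = xhi b /\ q.1 = xhi b].
Proof.
case: e => -[e1x e1y] [e2x e2y].
case: s => [||a b|a|a|a] //= ok; case: k => [|[|[|[|k]]]] //= _; rewrite ?inE;
rewrite ?(orbA, orbF) => h; repeat (case/orP: h => h);
move/eqP: h => [-> -> -> ->];
rewrite /dash_bottom /dash_top /dash_left /dash_right /box
  /corner_bl /corner_br /corner_tl /corner_tr /=;
first [apply: Or41; lia | apply: Or42; lia | apply: Or43; lia | apply: Or44; lia].
Qed.

(** Converse of [dashedP]. A turn may reverse the direction of a side, hence the two orders of its
    ends. *)
Lemma dashed_exists s k x y : proto_ok s -> (k < 4)%N ->
  let b := code_bounds s k x y in
  let side p q := exists2 e, e \in int_dashed s &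
    int_place k x y e.1 = p /\ int_place k x y e.2 = q \/
    int_place k x y e.1 = q /\ int_place k x y e.2 = p in
  [/\ dash_bottom b -> side (xlo b, ylo b) (xhi b, ylo b),
      dash_top b -> side (xlo b, yhi b) (xhi b, yhi b),
      dash_left b -> side (xlo b, ylo b) (xlo b, yhi b) &
      dash_right b -> side (xhi b, ylo b) (xhi b, yhi b)].
Proof.
have pairE (u v u' v' : int) : u = u' -> v = v' -> (u, v) = (u', v').
  by move=> -> ->.
case: s => [||a b|a|a|a] //= ok; case: k => [|[|[|[|k]]]] //= _;
rewrite /dash_bottom /dash_top /dash_left /dash_right /box
  /corner_bl /corner_br /corner_tl /corner_tr /=; split=> h; try (exfalso; lia).
1-4: exists ((0, 0), (2 * a%:R + 2, 0)); rewrite ?inE ?eqxx //;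
  first [by left; split; apply: pairE => /=; lia
        |by right; split; apply: pairE => /=; lia].
all: first [exists ((0, 0), (a%:R, 0)); rewrite ?inE ?eqxx //;
    first [by left; split; apply: pairE => /=; lia
          |by right; split; apply: pairE => /=; lia]
  |exists ((0, 0), (0, a%:R)); rewrite ?inE ?eqxx ?orbT //;
    first [by left; split; apply: pairE => /=; lia
          |by right; split; apply: pairE => /=; lia]].
Qed.

(** * Zero blocks as placed prototiles *)

Section TileBounds.
Variables M N c : int.
Hypotheses (M1 : 1 <= M) (N1 : 1 <= N) (c01 : 0 <= c <= 1).
Local Notation lat_rect := (lat_rect M N c).
Local Notation gap_rect := (gap_rect M N c).
Local Notation cell_rect := (cell_rect M N c).
Local Notation valid := (valid M N c).

(** The octagon cut by the rectangle. Terms such as [xl + yl] keep the diagonal bounds tight after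
    the cut. *)
Definition ctile_bounds t : bounds int :=
  match t with
  | Dia i j => Bounds (i + j + c) (i + j + c + 2) (i - j - 1) (i - j + 1)
      (2 * i + c) (2 * i + c + 2) (2 * j + c) (2 * j + c + 2)
  | Blk i0 i1 j0 j1 =>
      let xl := Num.max 0 (i0 + j0 - 1 + c) in
      let xh := Num.min M (i1 + j1 + 1 + c) in
      let yl := Num.max 0 (i0 - j1 - 1) in
      let yh := Num.min N (i1 - j0 + 1) in
      Bounds xl xh yl yh
        (Num.max (2 * (i0 - 1) + c) (xl + yl))
        (Num.min (2 * (i1 + 1) + c) (xh + yh))
        (Num.max (2 * (j0 - 1) + c) (xl - yh))
        (Num.min (2 * (j1 + 1) + c) (xh - yl))
  end.

(** The nine positions of a tile: inner, on one of four sides (trapezoid), in one of four corners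
    (triangle). Each has bounds without [Num.max] and [Num.min], which leaves linear arithmetic. *)
Inductive blk_spec (i0 i1 j0 j1 : int) : bounds int -> Prop :=
| BlkInner of i0 <= i1 & j0 <= j1 & 0 <= i0 - j1 - 1 & i1 - j0 + 1 <= N &
    0 <= i0 + j0 - 1 + c & i1 + j1 + 1 + c <= M :
    blk_spec i0 i1 j0 j1 (Bounds (i0 + j0 - 1 + c) (i1 + j1 + 1 + c)
      (i0 - j1 - 1) (i1 - j0 + 1)
      (2 * (i0 - 1) + c) (2 * (i1 + 1) + c) (2 * (j0 - 1) + c) (2 * (j1 + 1) + c))
| BlkBottom of i0 < i1 & j0 = i0 + 1 & j1 = i1 + 1 & i1 - i0 <= N &
    0 <= 2 * i0 + c & 2 * i1 + 2 + c <= M :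
    blk_spec i0 i1 j0 j1 (Bounds (2 * i0 + c) (2 * i1 + 2 + c)
      0 (i1 - i0) (2 * i0 + c) (2 * i1 + 2 + c) (2 * i0 + c) (2 * i1 + 2 + c))
| BlkTop of i0 < i1 & i0 = j0 + N + 1 & i1 = j1 + N + 1 & i1 - i0 <= N &
    0 <= 2 * i0 - N - 2 + c & 2 * i1 - N + c <= M :
    blk_spec i0 i1 j0 j1 (Bounds (2 * i0 - N - 2 + c) (2 * i1 - N + c)
      (N - i1 + i0) N (2 * i0 - 2 + c) (2 * i1 + c)
      (2 * j0 + c) (2 * j1 + 2 + c))
| BlkLeft of i0 < i1 & j0 = - 1 - c - i1 & j1 = - 1 - c - i0 & i1 - i0 <= M &
    0 <= 2 * i0 + c & 2 * i1 + 2 + c <= N :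
    blk_spec i0 i1 j0 j1 (Bounds 0 (i1 - i0) (2 * i0 + c) (2 * i1 + 2 + c)
      (2 * i0 + c) (2 * i1 + 2 + c) (- 2 * i1 - 2 - c) (- 2 * i0 - c))
| BlkRight of i0 < i1 & j0 = M + 1 - c - i1 & j1 = M + 1 - c - i0 &
    i1 - i0 <= M & 0 <= 2 * i0 - M - 2 + c & 2 * i1 - M + c <= N :
    blk_spec i0 i1 j0 j1 (Bounds (M - i1 + i0) M
      (2 * i0 - M - 2 + c) (2 * i1 - M + c)
      (2 * i0 - 2 + c) (2 * i1 + c) (2 * j0 - 2 + c) (2 * j1 + c))
| BlkBottomLeft of i0 < i1 & j0 = i0 + 1 & j1 = i1 + 1 &
    j0 = - 1 - c - i1 & i1 - i0 <= M & i1 - i0 <= N :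
    blk_spec i0 i1 j0 j1 (Bounds 0 (i1 - i0) 0 (i1 - i0)
      0 (i1 - i0) (- i1 + i0) (i1 - i0))
| BlkBottomRight of i0 < i1 & j0 = i0 + 1 & j1 = i1 + 1 &
    j0 = M + 1 - c - i1 & i1 - i0 <= M & i1 - i0 <= N :
    blk_spec i0 i1 j0 j1 (Bounds (M - i1 + i0) M 0 (i1 - i0)
      (M - i1 + i0) (M + i1 - i0) (M - i1 + i0) M)
| BlkTopLeft of i0 < i1 & i0 = j0 + N + 1 & i1 = j1 + N + 1 &
    j0 = - 1 - c - i1 & i1 - i0 <= M & i1 - i0 <= N :
    blk_spec i0 i1 j0 j1 (Bounds 0 (i1 - i0) (N - i1 + i0) N
      (N - i1 + i0) (N + i1 - i0) (- N) (- N + i1 - i0))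
| BlkTopRight of i0 < i1 & i0 = j0 + N + 1 & i1 = j1 + N + 1 &
    j0 = M + 1 - c - i1 & i1 - i0 <= M & i1 - i0 <= N :
    blk_spec i0 i1 j0 j1 (Bounds (M - i1 + i0) M (N - i1 + i0) N
      (M + N - i1 + i0) (M + N) (M - N - i1 + i0) (M - N + i1 - i0)).

Lemma bounds_congr (T : Type) (x x' y y' s s' t t' a a' b b' d d' e e' : T) :
  x = x' -> y = y' -> s = s' -> t = t' -> a = a' -> b = b' -> d = d' -> e = e' ->
  Bounds x y s t a b d e = Bounds x' y' s' t' a' b' d' e'.
Proof. by do 8!move=> ->. Qed.

Lemma blkP i0 i1 j0 j1 : valid (Blk i0 i1 j0 j1) ->
  blk_spec i0 i1 j0 j1 (ctile_bounds (Blk i0 i1 j0 j1)).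
Proof.
have sub b b' : b' = b -> blk_spec i0 i1 j0 j1 b -> blk_spec i0 i1 j0 j1 b'.
  by move=> ->.
move=> /and5P[ii jj vB vT /andP[vL vR]]; rewrite /ctile_bounds.
have {}vB : 0 <= i0 - j1 - 1 \/ [/\ j0 = i0 + 1, j1 = i1 + 1 & i0 < i1].
  by case/orP: vB => [->|/and3P[/eqP ? /eqP ? ?]]; [left|right].
have {}vT : i1 - j0 + 1 <= N \/ [/\ i0 = j0 + N + 1, i1 = j1 + N + 1 & i0 < i1].
  by case/orP: vT => [->|/and3P[/eqP ? /eqP ? ?]]; [left|right].
have {}vL : 0 <= i0 + j0 - 1 + c \/
    [/\ j0 = - 1 - c - i1, j1 = - 1 - c - i0 & i0 < i1].
  by case/orP: vL => [->|/and3P[/eqP ? /eqP ? ?]]; [left|right].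
have {}vR : i1 + j1 + 1 + c <= M \/
    [/\ j0 = M + 1 - c - i1, j1 = M + 1 - c - i0 & i0 < i1].
  by case/orP: vR => [->|/and3P[/eqP ? /eqP ? ?]]; [left|right].
(* Symmetry about two opposite lines would force [N = -2] or [M = -2]; nine of the sixteen cases
   remain. *)
case: vB vT vL vR => [B|[b1 b2 b3]] [T|[t1 t2 t3]] [L|[l1 l2 l3]] [D|[d1 d2 d3]];
  try (exfalso; lia).
- by apply: sub (BlkInner _ _ _ _ _ _); [apply: bounds_congr|..] => //; lia.
- by apply: sub (BlkRight _ _ _ _ _ _); [apply: bounds_congr|..] => //; lia.
- by apply: sub (BlkLeft _ _ _ _ _ _); [apply: bounds_congr|..] => //; lia.
- by apply: sub (BlkTop _ _ _ _ _ _); [apply: bounds_congr|..] => //; lia.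
- by apply: sub (BlkTopRight _ _ _ _ _ _); [apply: bounds_congr|..] => //; lia.
- by apply: sub (BlkTopLeft _ _ _ _ _ _); [apply: bounds_congr|..] => //; lia.
- by apply: sub (BlkBottom _ _ _ _ _ _); [apply: bounds_congr|..] => //; lia.
- by apply: sub (BlkBottomRight _ _ _ _ _ _); [apply: bounds_congr|..] => //; lia.
- by apply: sub (BlkBottomLeft _ _ _ _ _ _); [apply: bounds_congr|..] => //; lia.
Qed.

Lemma blk_spec_valid i0 i1 j0 j1 b : blk_spec i0 i1 j0 j1 b ->
  valid (Blk i0 i1 j0 j1) /\ ctile_bounds (Blk i0 i1 j0 j1) = b.
Proof.
by case=> ? ? ? ? ? ?; split; first [apply: bounds_congr; lia|rewrite /valid; lia].
Qed.

Lemma ctile_dash_ok t : valid t -> dash_ok M N (ctile_bounds t).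
Proof.
case: t => [i j|i0 i1 j0 j1] v.
  rewrite /dash_ok /dash_bottom /dash_top /dash_left /dash_right /box.
  by rewrite /corner_bl /corner_br /corner_tl /corner_tr /=; lia.
case: (blkP v) => *;
rewrite /dash_ok /dash_bottom /dash_top /dash_left /dash_right /box
  /corner_bl /corner_br /corner_tl /corner_tr /=; lia.
Qed.

Lemma ctile_colour t : valid t -> (2 %| colour_bound (ctile_bounds t) - c)%Z.
Proof.
case: t => [i j|i0 i1 j0 j1] v; first by rewrite /colour_bound /=; case: ifP; lia.
by case: (blkP v) => *; rewrite /colour_bound /=; case: ifP; lia.
Qed.

Lemma ctile_in_rect t : valid t -> let b := ctile_bounds t in
  [/\ 0 <= xlo b, xhi b <= M, 0 <= ylo b & yhi b <= N].
Proof.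
case: t => [i j|i0 i1 j0 j1] v /=; first by move: v => /= v; split; lia.
by split; lia.
Qed.

Lemma ctile_bounds_inj t t' : valid t -> valid t' ->
  ctile_bounds t = ctile_bounds t' -> t = t'.
Proof.
have blk_eq (i0 i1 j0 j1 i0' i1' j0' j1' : int) : 
    [&& i0 == i0', i1 == i1', j0 == j0' & j1 == j1'] ->
    Blk i0 i1 j0 j1 = Blk i0' i1' j0' j1'.
  by move=> /and4P[/eqP -> /eqP -> /eqP -> /eqP ->].
case: t t' => [i j|i0 i1 j0 j1] [i' j'|i0' i1' j0' j1'] v v'.
- by case=> *; congr Dia; lia.
- by case: (blkP v') => ? ? ? ? ? ? [] *; exfalso; lia.
- by case: (blkP v) => ? ? ? ? ? ? [] *; exfalso; lia.
by case: (blkP v) => ? ? ? ? ? ?; case: (blkP v') => ? ? ? ? ? ? [] *;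
  apply: blk_eq; lia.
Qed.

Lemma ctile_code t : valid t -> exists s k x y,
  [/\ proto_ok s, (k < 4)%N & code_bounds s k x y = ctile_bounds t].
Proof.
case: t => [i j|i0 i1 j0 j1] v.
  exists Diamond, 0%N, (i + j + 1 + c), (i - j - 1); split=> //.
  by apply: bounds_congr; rewrite /=; lia.
case: (blkP v) => h; move: (h) => _ *.
(* The shift is the image of the vertex (0, 0): the lower left corner of the lowest square, centred
   at [(i0, j1)], or for the turned hexagon the lower right corner of the rightmost square, centred
   at [(i1, j0)]. *)
- have [ea|na] := eqVneq i0 i1.
    have [eb|nb] := eqVneq j0 j1.
      exists Square, 0%N, (i0 + j0 - 1 + c), (i0 - j0 - 1); split=> //.
      by apply: bounds_congr; rewrite /=; lia.
    exists (Hexagon (absz (j1 - j0)%R)), 0%N, (i0 + j1 - 1 + c), (i0 - j1 - 1).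
    by split=> //=; [lia|apply: bounds_congr; rewrite /=; lia].
  have [eb|nb] := eqVneq j0 j1.
    exists (Hexagon (absz (i1 - i0)%R)), 1%N, (i1 + j0 + 1 + c), (i1 - j0 - 1).
    by split=> //=; [lia|apply: bounds_congr; rewrite /=; lia].
  exists (Octagon (absz (i1 - i0)%R) (absz (j1 - j0)%R)), 0%N,
    (i0 + j1 - 1 + c), (i0 - j1 - 1).
  by split=> //=; [lia|apply: bounds_congr; rewrite /=; lia].
- exists (Trapezoid (absz (i1 - i0)%R)), 0%N, (2 * i0 + c), 0.
  by split=> //=; [lia|apply: bounds_congr; rewrite /=; lia].
- exists (Trapezoid (absz (i1 - i0)%R)), 2%N, (2 * i1 - N + c), N.
  by split=> //=; [lia|apply: bounds_congr; rewrite /=; lia].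
- exists (Trapezoid (absz (i1 - i0)%R)), 3%N, 0, (2 * i1 + 2 + c).
  by split=> //=; [lia|apply: bounds_congr; rewrite /=; lia].
- exists (Trapezoid (absz (i1 - i0)%R)), 1%N, M, (2 * i0 - M - 2 + c).
  by split=> //=; [lia|apply: bounds_congr; rewrite /=; lia].
- exists (Triangle (absz (i1 - i0)%R)), 0%N, 0, 0.
  by split=> //=; [lia|apply: bounds_congr; rewrite /=; lia].
- exists (Triangle (absz (i1 - i0)%R)), 1%N, M, 0.
  by split=> //=; [lia|apply: bounds_congr; rewrite /=; lia].
- exists (Triangle (absz (i1 - i0)%R)), 3%N, 0, N.
  by split=> //=; [lia|apply: bounds_congr; rewrite /=; lia].
- exists (Triangle (absz (i1 - i0)%R)), 2%N, M, N.
  by split=> //=; [lia|apply: bounds_congr; rewrite /=; lia].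
Qed.
End TileBounds.

(** * Placed prototiles as zero blocks, and half squares against bounds *)

Section CodeTiles.
Variables M N c : int.
Hypotheses (M1 : 1 <= M) (N1 : 1 <= N) (c01 : 0 <= c <= 1).
Local Notation lat_rect := (lat_rect M N c).
Local Notation gap_rect := (gap_rect M N c).
Local Notation cell_rect := (cell_rect M N c).
Local Notation valid := (valid M N c).
Local Notation ctile_bounds := (ctile_bounds M N c).

(** A dashed side on the boundary fixes the shift in its normal direction; this yields the symmetry
    equations of the block. *)
Lemma dash_position s k x y : proto_ok s -> (k < 4)%N ->
  dash_ok M N (code_bounds s k x y) ->
  match s, k with
  | Trapezoid _, 0%N => y = 0
  | Trapezoid _, 1%N => x = M
  | Trapezoid _, 2%N => y = N
  | Trapezoid _, _ => x = 0
  | Triangle _, 0%N => x = 0 /\ y = 0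
  | Triangle _, 1%N => x = M /\ y = 0
  | Triangle _, 2%N => x = M /\ y = N
  | Triangle _, _ => x = 0 /\ y = N
  | _, _ => True
  end.
Proof.
rewrite /dash_ok /dash_bottom /dash_top /dash_left /dash_right.
rewrite /box /corner_bl /corner_br /corner_tl /corner_tr.
by case: s => [||a b|a|a|a] //= ok; case: k => [|[|[|[|k]]]] //= _; move: ok; clear; lia.
Qed.

Lemma code_ctile s k x y : proto_ok s -> (k < 4)%N ->
  let b := code_bounds s k x y in
  (2 %| colour_bound b - c)%Z ->
  [/\ 0 <= xlo b, xhi b <= M, 0 <= ylo b & yhi b <= N] ->
  dash_ok M N b ->
  exists2 t, valid t & b = ctile_bounds t.
Proof.
move=> ok k4 b.
(* The zero block is read off the diagonal sides that are not dashed. *)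
have floor (z : int) : exists i, (2 %| z - c)%Z -> 2 * i + c = z.
  by exists ((z - c)%R %/ 2)%Z; clear; lia.
have [i0 i0E] := floor (slo b + 2); have [i1 i1E] := floor (shi b - 2).
have [j0 j0E] := floor (tlo b + 2); have [j1 j1E] := floor (thi b - 2).
move=> col [r1 r2 r3 r4] /(dash_position ok k4) dash.
have fin k0 k1 l0 l1 B : blk_spec M N c k0 k1 l0 l1 B -> b = B ->
    exists2 t, valid t & b = ctile_bounds t.
  move=> /(blk_spec_valid M1 N1 c01)[v <-] ->.
  by exists (Blk k0 k1 l0 l1).
have fin' i j B : ctile_bounds (Dia i j) = B -> valid (Dia i j) -> b = B ->
    exists2 t, valid t & b = ctile_bounds t.
  by move=> <- v ->; exists (Dia i j).
clear floor; move: ok k4 col r1 r2 r3 r4 dash i0E i1E j0E j1E fin fin'.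
rewrite {}/b /colour_bound.
case: s => [||a b|a|a|a] /= ok; case: k => [|[|[|[|k]]]] //= _;
  case: ifP => h; try (by move=> *; exfalso; move: ok h; clear; lia);
  move=> col r1 r2 r3 r4 dash i0E i1E j0E j1E fin fin';
  (try have {}i0E := i0E ltac:(clear -col dash; lia));
  (try have {}i1E := i1E ltac:(clear -col dash; lia));
  (try have {}j0E := j0E ltac:(clear -col dash; lia));
  (try have {}j1E := j1E ltac:(clear -col dash; lia)).
all: clear col h.
(* Both orders of the octagon parameters survive [ifP], so octagons fill goals 9 to 16, hexagons 17
   to 20, and goal 21 is each time the first trapezoid or triangle left. Block coordinates that no
   undashed diagonal side gives are mirror images of the others. *)
21: apply: (fin (j0 - 1) i1 j0 (i1 + 1));
  [by apply: BlkBottom; clear fin fin'; lia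
  |by apply: bounds_congr; clear fin fin'; rewrite /=; lia].
21: apply: (fin i0 (M + 1 - c - j0) j0 (M + 1 - c - i0));
  [by apply: BlkRight; clear fin fin'; lia
  |by apply: bounds_congr; clear fin fin'; rewrite /=; lia].
21: apply: (fin i0 (j1 + N + 1) (i0 - N - 1) j1);
  [by apply: BlkTop; clear fin fin'; lia
  |by apply: bounds_congr; clear fin fin'; rewrite /=; lia].
21: apply: (fin (- 1 - c - j1) i1 (- 1 - c - i1) j1);
  [by apply: BlkLeft; clear fin fin'; lia
  |by apply: bounds_congr; clear fin fin'; rewrite /=; lia].
21: apply: (fin (- 2 - c - i1) i1 (- 1 - c - i1) (i1 + 1));
  [by apply: BlkBottomLeft; clear fin fin'; lia
  |by apply: bounds_congr; clear fin fin'; rewrite /=; lia].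
21: apply: (fin (j0 - 1) (M + 1 - c - j0) j0 (M + 2 - c - j0));
  [by apply: BlkBottomRight; clear fin fin'; lia
  |by apply: bounds_congr; clear fin fin'; rewrite /=; lia].
21: apply: (fin i0 (M + N + 2 - c - i0) (i0 - N - 1) (M + 1 - c - i0));
  [by apply: BlkTopRight; clear fin fin'; lia
  |by apply: bounds_congr; clear fin fin'; rewrite /=; lia].
21: apply: (fin (- 1 - c - j1) (j1 + N + 1) (- 2 - c - j1 - N) j1);
  [by apply: BlkTopLeft; clear fin fin'; lia
  |by apply: bounds_congr; clear fin fin'; rewrite /=; lia].
5-8: apply: (fin' (i0 - 1) (j0 - 1) _ erefl);
  [by clear fin fin'; lia
  |by apply: bounds_congr; clear fin fin'; rewrite /=; lia].
all: apply: (fin i0 i1 j0 j1);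
  [by apply: BlkInner; clear fin fin'; lia
  |by apply: bounds_congr; clear fin fin'; rewrite /=; lia].
Qed.

Definition in_bounds (b : bounds int) (x y : int) : bool :=
  [&& xlo b <= x <= xhi b, ylo b <= y <= yhi b,
    slo b <= x + y <= shi b & tlo b <= x - y <= thi b].

Definition cell_in_bounds (b : bounds int) (i j e f : int) : bool :=
  let x := i + j + 1 + c in let y := i - j in
  [&& in_bounds b x y, in_bounds b (x - 1 + 2 * e) y &
    in_bounds b x (y - 1 + 2 * f)].

(* Satisfied as soon as an interior point of the half square is in the
   region. *)
Definition cell_meets_bounds (b : bounds int) (i j e f : int) : bool :=
  let x := i + j + 1 + c in let y := i - j in
  [&& xlo b <= x - 1 + e, x + e <= xhi b, ylo b <= y - 1 + f, y + f <= yhi b &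
    if e == f then
      [&& slo b <= x + y - 1 + e, x + y + e <= shi b & tlo b <= x - y <= thi b]
    else
      [&& tlo b <= x - y - 1 + e, x - y + e <= thi b & slo b <= x + y <= shi b]].

(** The axis-parallel bounds of the octagon are integers and its diagonal bounds have the parity of
    coloured points, so none of its sides cuts a half square. The cut bounds [B] imply those of the
    octagon. [in_tile_cell_in] is the converse direction. *)
Lemma cell_meets_in_tile t i j e f : valid t -> cell_rect i j e f ->
  cell_meets_bounds (ctile_bounds t) i j e f -> in_tile t i j e f.
Proof.
move=> v /and5P[he hf w rh rv].
have e01 : e = 0 \/ e = 1 by clear -he; lia.
have f01 : f = 0 \/ f = 1 by clear -hf; lia.
case: t v => [k l|i0 i1 j0 j1] v.
  rewrite /cell_meets_bounds /=.
  by case: e01 => ->; case: f01 => ->; case: ifP; lia.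
have [ii jj] : i0 <= i1 /\ j0 <= j1 by case/and5P: v.
have raw : let B := ctile_bounds (Blk i0 i1 j0 j1) in
  [/\ i0 + j0 - 1 + c <= xlo B, xhi B <= i1 + j1 + 1 + c,
    i0 - j1 - 1 <= ylo B & yhi B <= i1 - j0 + 1] /\
  [/\ 2 * (i0 - 1) + c <= slo B, shi B <= 2 * (i1 + 1) + c,
    2 * (j0 - 1) + c <= tlo B & thi B <= 2 * (j1 + 1) + c].
  by split; split; rewrite /= ?le_max ?ge_min lexx ?orbT.
move: (ctile_bounds _) raw => B [[r1 r2 r3 r4] [r5 r6 r7 r8]].
rewrite /cell_meets_bounds /in_tile /in_blk; clear v w rh rv.
by case: e01 => ->; case: f01 => ->; case: ifP => h /and5P[m1 m2 m3 m4 m5]; lia.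
Qed.

Lemma in_tile_cell_in t i j e f : valid t -> cell_rect i j e f ->
  in_tile t i j e f -> cell_in_bounds (ctile_bounds t) i j e f.
Proof.
move=> v /and5P[he hf w rh rv].
have e01 : e = 0 \/ e = 1 by clear -he; lia.
have f01 : f = 0 \/ f = 1 by clear -hf; lia.
case: t v => [k l|i0 i1 j0 j1] v.
  rewrite /cell_in_bounds /in_bounds /=.
  by case: e01 => ->; case: f01 => ->; lia.
move: w rh rv; rewrite /gap_rect /lat_rect /in_rect.
have /and5P[ii jj _ _ _] := v.
rewrite /in_tile /in_blk => w rh rv it.
by case: (blkP M1 N1 c01 v); rewrite /cell_in_bounds /in_bounds /=;
  case: e01 it rh rv => ->; case: f01 => -> /=; lia.
Qed.

End CodeTiles.

(** * Half squares in the plane *)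

Section Plane.
Context {R : realType}.

Lemma interior_boxP (A : set (R * R)) (p : R * R) : interior A p <->
  exists2 e, 0 < e &
    forall q, `|p.1 - q.1| < e -> `|p.2 - q.2| < e -> A q.
Proof.
split=> [/nbhs_ballP[e /= e0 sub]|[e e0 sub]].
  by exists e => // q h1 h2; apply: sub; split.
by apply/nbhs_ballP; exists e => //= q [h1 h2]; apply: sub.
Qed.

(** This moves a common interior point of two tiles off the edges of the half squares. The length
    [l] keeps both coordinate displacements at most half of [Num.min e d]. *)
Lemma interior_segment (A B : set (R * R)) (p q : R * R) :
  interior A p -> interior B p ->
  exists2 l, 0 < l <= 1 & let r := (p.1 + l * (q.1 - p.1), p.2 + l * (q.2 - p.2))
    in A r /\ B r.
Proof.
move=> /interior_boxP[e e0 eA] /interior_boxP[d d0 dB].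
pose m := Num.max `|q.1 - p.1| `|q.2 - p.2| + 1.
have m0 : 0 < m by rewrite ltr_wpDl // le_max normr_ge0.
pose l := Num.min 1 (Num.min e d / m / 2).
have ed0 : 0 < Num.min e d by rewrite lt_min e0.
have l0 : 0 < l by rewrite lt_min ltr01 /= !divr_gt0.
exists l; first by rewrite l0 ge_min lexx.
have small (z : R) : `|z| <= m -> `|l * z| < Num.min e d.
  move=> zm; rewrite normrM (gtr0_norm l0).
  apply: (@le_lt_trans _ _ (Num.min e d / 2)); last by lra.
  have lm : l <= Num.min e d / m / 2 by rewrite ge_min lexx orbT.
  apply: (@le_trans _ _ (Num.min e d / m / 2 * m)).
    by apply: ler_pM => //; exact: ltW.
  by rewrite le_eqVlt; apply/orP; left; apply/eqP; field; rewrite gt_eqF.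
have zm1 : `|q.1 - p.1| <= m.
  by rewrite (@le_trans _ _ (Num.max `|q.1 - p.1| `|q.2 - p.2|)) // ?le_max ?lexx //
    lerDl.
have zm2 : `|q.2 - p.2| <= m.
  by rewrite (@le_trans _ _ (Num.max `|q.1 - p.1| `|q.2 - p.2|)) //
    ?le_max ?lexx ?orbT // lerDl.
have dist (x y : R) : `|x - (x + l * y)| = `|l * y|.
  by rewrite opprD addNKr normrN.
have := small _ zm1; have := small _ zm2.
rewrite !lt_min => /andP[s1 s2] /andP[s3 s4].
by split; [apply: eA|apply: dB]; rewrite /= dist.
Qed.

Variables m n : nat.
Hypotheses (hm : (2 <= m)%N) (hn : (2 <= n)%N).
Local Notation D := (rectangle R m n).

Lemma interior_rectangle p : D p -> interior D p <->
  0 < p.1 < m%:R - 1 /\ 0 < p.2 < n%:R - 1.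
Proof.
move=> _; split=> [/interior_boxP[e e0 sub]|[/andP[h1 h2] /andP[h3 h4]]].
  have e2 (x : R) : `|x - (x + e / 2)| < e.
    by rewrite opprD addNKr normrN gtr0_norm; lra.
  have e2' (x : R) : `|x - (x - e / 2)| < e.
    by rewrite opprB addrC subrK gtr0_norm; lra.
  have c0 (x : R) : `|x - x| < e by rewrite subrr normr0.
  have [] := sub (p.1 + e / 2, p.2) (e2 _) (c0 _).
  have [] := sub (p.1 - e / 2, p.2) (e2' _) (c0 _).
  have [] := sub (p.1, p.2 + e / 2) (c0 _) (e2 _).
  have [] := sub (p.1, p.2 - e / 2) (c0 _) (e2' _).
  by rewrite /=; move=> *; split; lra.
apply/interior_boxP.
exists (Num.min (Num.min p.1 (m%:R - 1 - p.1)) (Num.min p.2 (n%:R - 1 - p.2))).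
  by rewrite !lt_min h1 h3 !subr_gt0 h2.
move=> q; rewrite !lt_min !ltr_distl.
by move=> /andP[/andP[a1 a2] _] /andP[_ /andP[a3 a4]]; split; lra.
Qed.

Lemma boundary_rectangle p : D p -> boundary D p <->
  [\/ p.1 = 0, p.1 = m%:R - 1, p.2 = 0 | p.2 = n%:R - 1].
Proof.
move=> Dp; have [/andP[a1 a2] /andP[a3 a4]] := Dp.
split=> [[_ nI]|h].
  have [/eqP ?|n1] := boolP (p.1 == 0); first exact: Or41.
  have [/eqP ?|n2] := boolP (p.1 == m%:R - 1); first exact: Or42.
  have [/eqP ?|n3] := boolP (p.2 == 0); first exact: Or43.
  have [/eqP ?|n4] := boolP (p.2 == n%:R - 1); first exact: Or44.
  case: nI; apply/(interior_rectangle Dp).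
  by rewrite !lt_neqAle a1 a2 a3 a4 n2 n4 ![_ == 0]eq_sym in n1 n3 *; rewrite n1 n3.
split; first exact: subset_closure.
by move/(interior_rectangle Dp) => [/andP[b1 b2] /andP[b3 b4]]; case: h => h; lra.
Qed.

End Plane.

Section Cells.
Context {R : realType}.
Variables M N c : int.
Hypotheses (M1 : 1 <= M) (N1 : 1 <= N) (c01 : 0 <= c <= 1).
Local Notation cell_rect := (cell_rect M N c).

Definition real_bounds (b : bounds int) : bounds R :=
  map_bounds (fun z : int => z%:~R) b.

(* The point with coordinates [al], [be] in the frame of the half square whose
   vertices are [(0, 0)], [(1, 0)] and [(0, 1)]. *)
Definition cell_point (i j e f : int) (al be : R) : R * R :=
  ((i + j + 1 + c)%:~R + (2 * e%:~R - 1) * al,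
   (i - j)%:~R + (2 * f%:~R - 1) * be).

(** The diagonal through the two coloured corners of a unit square cuts it into half squares; the
    parity of [X + Y + c] tells which diagonal that is. *)
Lemma cell_cover (p : R * R) : 0 <= p.1 <= M%:~R -> 0 <= p.2 <= N%:~R ->
  exists i j e f al be, [/\ cell_rect i j e f, p = cell_point i j e f al be,
    0 <= al, 0 <= be & al + be <= 1].
Proof.
have unit_floor (K : int) (x : R) : 1 <= K -> 0 <= x <= K%:~R ->
    exists z : int, [/\ 0 <= z, z <= K - 1 & 0 <= x - z%:~R <= 1].
  move=> K1 /andP[x0 xK].
  have [z0 z1] : (Num.floor x)%:~R <= x /\ x < (Num.floor x + 1)%:~R.
    by rewrite floor_le floorD1_gt.
  have f0 : 0 <= Num.floor x by rewrite floor_ge_int.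
  have [fK|fK] := lerP (Num.floor x) (K - 1).
    exists (Num.floor x); split=> //; move: z1; rewrite intrD mulr1z; lra.
  (* Here [x = K], the right end of the last unit interval. *)
  exists (K - 1); split; [lia|lia|].
  have KR : K%:~R <= x :> R.
    by apply: le_trans z0; rewrite ler_int; lia.
  by rewrite intrB mulr1z; lra.
move=> /(unit_floor _ _ M1)[X [X0 XM hX]] /(unit_floor _ _ N1)[Y [Y0 YN hY]].
have pE (i j e f : int) (al be : R) : p.1 = (cell_point i j e f al be).1 ->
    p.2 = (cell_point i j e f al be).2 -> p = cell_point i j e f al be.
  by case: (p) => u v /= -> ->.
have cell (i j wx wy e f : int) : i + j + 1 + c = wx -> i - j = wy ->
    0 <= e <= 1 -> 0 <= f <= 1 ->
    0 <= wx <= M -> 0 <= wy <= N -> 0 <= wx - 1 + 2 * e <= M ->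
    0 <= wy - 1 + 2 * f <= N -> cell_rect i j e f.
  by rewrite /cell_rect /gap_rect /lat_rect /in_rect; clear; lia.
pose h := ((X + Y + c)%R %/ 2)%Z.
have [par|par] : X + Y + c = 2 * h \/ X + Y + c = 2 * h + 1 by rewrite /h; lia.
- have [le|gt] := lerP ((X%:~R + 1 - p.1) + (p.2 - Y%:~R)) 1.
    exists (h - c), (X - h), 0, 1, (X%:~R + 1 - p.1), (p.2 - Y%:~R).
    have ex : h - c + (X - h) + 1 + c = X + 1 by lia.
    have ey : h - c - (X - h) = Y by lia.
    split; [by apply: (cell _ _ _ _ _ _ ex ey); lia| |lra|lra|lra].
    by apply: pE; rewrite /= ?ex ?ey ?intrD mulr1z ?mulr0z; ring.
  exists (h - c), (X - 1 - h), 1, 0, (p.1 - X%:~R), (Y%:~R + 1 - p.2).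
  have ex : h - c + (X - 1 - h) + 1 + c = X by lia.
  have ey : h - c - (X - 1 - h) = Y + 1 by lia.
  split; [by apply: (cell _ _ _ _ _ _ ex ey); lia| |lra|lra|lra].
  by apply: pE; rewrite /= ?ex ?ey ?intrD mulr1z ?mulr0z; ring.
have [le|gt] := lerP ((p.1 - X%:~R) + (p.2 - Y%:~R)) 1.
  exists (h - c), (X - 1 - h), 1, 1, (p.1 - X%:~R), (p.2 - Y%:~R).
  have ex : h - c + (X - 1 - h) + 1 + c = X by lia.
  have ey : h - c - (X - 1 - h) = Y by lia.
  split; [by apply: (cell _ _ _ _ _ _ ex ey); lia| |lra|lra|lra].
  by apply: pE; rewrite /= ?ex ?ey ?intrD mulr1z ?mulr0z; ring.
exists (h - c + 1), (X - h - 1), 0, 0, (X%:~R + 1 - p.1), (Y%:~R + 1 - p.2).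
have ex : h - c + 1 + (X - h - 1) + 1 + c = X + 1 by lia.
have ey : h - c + 1 - (X - h - 1) = Y + 1 by lia.
split; [by apply: (cell _ _ _ _ _ _ ex ey); lia| |lra|lra|lra].
by apply: pE; rewrite /= ?ex ?ey ?intrD mulr1z ?mulr0z; ring.
Qed.

Lemma in_boundsP b (x y : int) :
  in_bounds b x y -> region (real_bounds b) (x%:~R, y%:~R).
Proof.
rewrite /region /= -intrD -intrB !ler_int.
by move=> /and4P[*]; split.
Qed.

Lemma cell_point_region b i j e f (al be : R) :
  0 <= e <= 1 -> 0 <= f <= 1 -> cell_in_bounds c b i j e f ->
  0 <= al -> 0 <= be -> al + be <= 1 ->
  region (real_bounds b) (cell_point i j e f al be).
Proof.
move=> he hf /and3P[/in_boundsP b1 /in_boundsP b2 /in_boundsP b3] al0 be0 ab1.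
move: b1 b2 b3; rewrite /cell_point.
move: (i + j + 1 + c) (i - j) => x y [/= x1 y1 s1 t1] [/= x2 _ s2 t2] [/= _ y3 s3 t3].
have [ee|ee] : e = 0 \/ e = 1 by clear -he; lia.
  have [ff|ff] : f = 0 \/ f = 1 by clear -hf; lia.
    rewrite ee ff ?(intrD, intrB, mulr0z, mulr1z, mulr0, mulr1) in
      x1 y1 s1 t1 x2 s2 t2 y3 s3 t3 *.
    by split; rewrite /=; lra.
  rewrite ee ff ?(intrD, intrB, mulr0z, mulr1z, mulr0, mulr1) in
    x1 y1 s1 t1 x2 s2 t2 y3 s3 t3 *.
  by split; rewrite /=; lra.
have [ff|ff] : f = 0 \/ f = 1 by clear -hf; lia.
  rewrite ee ff ?(intrD, intrB, mulr0z, mulr1z, mulr0, mulr1) in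
    x1 y1 s1 t1 x2 s2 t2 y3 s3 t3 *.
  by split; rewrite /=; lra.
rewrite ee ff ?(intrD, intrB, mulr0z, mulr1z, mulr0, mulr1) in
  x1 y1 s1 t1 x2 s2 t2 y3 s3 t3 *.
by split; rewrite /=; lra.
Qed.

Lemma cell_point_meets b i j e f (al be : R) :
  0 <= e <= 1 -> 0 <= f <= 1 -> 0 < al -> 0 < be -> al + be < 1 ->
  region (real_bounds b) (cell_point i j e f al be) ->
  cell_meets_bounds c b i j e f.
Proof.
move=> he hf al0 be0 ab1; rewrite /cell_point /cell_meets_bounds.
move: (i + j + 1 + c) (i - j) => x y [/= x1 y1 s1 t1].
have le_int (u v : int) : u%:~R < v%:~R + 1 :> R -> u <= v.
  by rewrite -ltzD1 -(ltr_int R) intrD mulr1z.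
have [ee|ee] : e = 0 \/ e = 1 by clear -he; lia.
  have [ff|ff] : f = 0 \/ f = 1 by clear -hf; lia.
    rewrite ee ff ?(mulr0z, mulr1z) /= in x1 y1 s1 t1 *.
    by do ?(apply/andP; split); apply: le_int; rewrite ?(intrD, intrB, mulr1z); lra.
  rewrite ee ff ?(mulr0z, mulr1z) /= in x1 y1 s1 t1 *.
  by do ?(apply/andP; split); apply: le_int; rewrite ?(intrD, intrB, mulr1z); lra.
have [ff|ff] : f = 0 \/ f = 1 by clear -hf; lia.
  rewrite ee ff ?(mulr0z, mulr1z) /= in x1 y1 s1 t1 *.
  by do ?(apply/andP; split); apply: le_int; rewrite ?(intrD, intrB, mulr1z); lra.
rewrite ee ff ?(mulr0z, mulr1z) /= in x1 y1 s1 t1 *.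
by do ?(apply/andP; split); apply: le_int; rewrite ?(intrD, intrB, mulr1z); lra.
Qed.

(** The box of radius 1/8 about this point stays in the half square, because 3/8 + 3/8 < 1. *)
Definition cell_centre i j e f : R * R := cell_point i j e f 4^-1 4^-1.

Lemma cell_centre_interior b i j e f :
  0 <= e <= 1 -> 0 <= f <= 1 -> cell_in_bounds c b i j e f ->
  interior (region (real_bounds b)) (cell_centre i j e f).
Proof.
move=> he hf hc; apply/interior_boxP; exists 8^-1 => // q.
rewrite !ltr_distl => hx hy.
pose ex : R := 2 * e%:~R - 1; pose ey : R := 2 * f%:~R - 1.
have sq (z : int) : 0 <= z <= 1 -> 2 * z%:~R - 1 = 1 :> R \/ 2 * z%:~R - 1 = -1 :> R.
  move=> hz; have [->|->] : z = 0 \/ z = 1 by clear -hz; lia.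
    by right; rewrite mulr0z; ring.
  by left; rewrite mulr1z; ring.
have hex : ex = 1 \/ ex = -1 by apply: sq.
have hey : ey = 1 \/ ey = -1 by apply: sq.
have -> : q = cell_point i j e f (ex * (q.1 - (i + j + 1 + c)%:~R))
    (ey * (q.2 - (i - j)%:~R)).
  rewrite [LHS]surjective_pairing /cell_point -/ex -/ey.
  by congr pair; rewrite mulrA; [case: hex|case: hey] => ->; ring.
rewrite /cell_centre /cell_point /= -/ex -/ey in hx hy.
apply: cell_point_region => //; move: hx hy;
move: (_%:~R : R) ((i - j)%:~R : R) => x y.
- by case: hex => ->; lra.
- by case: hey => ->; lra.
- by case: hex => ->; case: hey => ->; lra.
Qed.

End Cells.

(** * The bijection *)

Section Link.
Context {R : realType}.
Implicit Types (t : tile (R := R)).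

Definition real_point (p : int * int) : R * R := (p.1%:~R, p.2%:~R).

Lemma real_point_inj : injective real_point.
Proof. by move=> [a b] [a' b'] [/intr_inj -> /intr_inj ->]. Qed.

Lemma real_bounds_inj : injective (@real_bounds R).
Proof.
move=> [? ? ? ? ? ? ? ?] [? ? ? ? ? ? ? ?].
by case=> /intr_inj -> /intr_inj -> /intr_inj -> /intr_inj -> /intr_inj ->
  /intr_inj -> /intr_inj -> /intr_inj ->.
Qed.

Lemma real_proto_bounds s :
  proto_bounds R s = real_bounds (proto_bounds int s).
Proof.
case: s => [||a b|a|a|a]; apply: bounds_congr => //=;
by rewrite ?(rmorphD, rmorphN, rmorphM, rmorphB) /= ?(rmorph_nat, mulr1z, mulr0z).
Qed.

Lemma real_turn_bounds b :
  turn_bounds (real_bounds b) = real_bounds (turn_bounds b) :> bounds R.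
Proof. by apply: bounds_congr => //=; rewrite rmorphN. Qed.

Lemma real_shift_bounds x y b :
  shift_bounds x%:~R y%:~R (real_bounds b) = real_bounds (shift_bounds x y b)
    :> bounds R.
Proof. by apply: bounds_congr => /=; rewrite ?(rmorphD, rmorphN). Qed.

Lemma tile_code t x y : tile_shift t = real_point (x, y) ->
  tile_bounds t =
  real_bounds (code_bounds (tile_proto t) (tile_turns t %% 4) x y).
Proof.
move=> e; rewrite /tile_bounds e /= /code_bounds -turn_bounds4.
rewrite real_proto_bounds -real_shift_bounds; congr shift_bounds.
by elim: (tile_turns t) => //= k ->; rewrite real_turn_bounds.
Qed.

Lemma int_turn4 k p : iter k int_turn p = iter (k %% 4) int_turn p.
Proof.
have turn4 q : iter 4 int_turn q = q.
  by case: q => *; rewrite /= /int_turn /= !opprK.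
rewrite {1}(divn_eq k 4) addnC iterD; congr (iter _ _ _).
elim: (k %/ 4)%N => // n IH; by rewrite mulSn iterD IH turn4.
Qed.

Lemma real_turn k p :
  iter k quarter_turn (real_point p) = real_point (iter k int_turn p).
Proof.
by elim: k => //= k ->; rewrite /quarter_turn /real_point /= rmorphN.
Qed.

Lemma real_place t x y p : tile_shift t = real_point (x, y) ->
  place t (real_point p) = real_point (int_place (tile_turns t %% 4) x y p).
Proof.
move=> e; rewrite /place e real_turn int_turn4 /int_place /real_point /=.
by rewrite !rmorphD.
Qed.

Lemma real_vertices s :
  proto_vertices s = [seq real_point p | p <- int_vertices s].
Proof.
have pairE (u v u' v' : R) : u = u' -> v = v' -> (u, v) = (u', v').
  by move=> -> ->.
have consE (p q : R * R) l l' : p = q -> l = l' -> p :: l = q :: l'.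
  by move=> -> ->.
case: s => [||a b|a|a|a]; rewrite /real_point /=;
repeat (apply: (consE); first by apply: (pairE);
  first [done|by rewrite rmorph_nat
    |by rewrite ?(rmorphD, rmorphN, rmorphM, rmorphB) /=
       ?(rmorph_nat, mulr1z, mulr0z)]);
by [].
Qed.

Lemma real_colour_vertices s :
  proto_color_vertices s = [seq real_point p | p <- int_colour_vertices s].
Proof.
by case: s => [||a b|a|a|a]; rewrite /proto_color_vertices real_vertices.
Qed.

Lemma real_dashed s :
  proto_dashed s = [seq (real_point e.1, real_point e.2) | e <- int_dashed s].
Proof.
case: s => [||a b|a|a|a] //=; rewrite /real_point /= ?mulr0z;
by rewrite ?(rmorphD, rmorphM) /= ?(rmorph_nat, mulr1z).
Qed.

(** Black is [c = 0] and white is [c = 1], so one argument serves both bijections. *)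
Definition coloured_point (c : int) (p : R * R) : Prop :=
  exists2 q, p = real_point q & (2 %| q.1 + q.2 - c)%Z.

Definition coloured_tile (c : int) t : Prop :=
  forall v, v \in proto_color_vertices (tile_proto t) ->
    coloured_point c (place t v).

(** The shift of a tile is an arbitrary real vector; one integral vertex makes it integral. *)
Lemma coloured_tile_code c t : coloured_tile c t -> exists x y,
  tile_shift t = real_point (x, y) /\
  (2 %| colour_bound (code_bounds (tile_proto t) (tile_turns t %% 4) x y) - c)%Z.
Proof.
move=> col; have ok := tile_ok t.
have [p ps] : exists p, p \in int_colour_vertices (tile_proto t).
  exists (head (0, 0) (int_colour_vertices (tile_proto t))).
  by case: (tile_proto t) => * /=; rewrite inE eqxx.
have [|q qE q2] := col (real_point p).
  by rewrite real_colour_vertices; apply: map_f.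
pose p' := iter (tile_turns t) int_turn p.
pose x := q.1 - p'.1; pose y := q.2 - p'.2.
have e : tile_shift t = real_point (x, y).
  move: qE; rewrite /place real_turn -/p' /real_point /= => -[e1 e2].
  rewrite [LHS]surjective_pairing /x /y !rmorphB /= -e1 -e2.
  by congr pair; rewrite addrC addKr.
exists x, y; split=> //; move: q2.
have <- : int_place (tile_turns t %% 4) x y p = q.
  by apply: real_point_inj; rewrite -(real_place _ e) qE.
have := colour_boundP x y ok (ltn_pmod (tile_turns t) (isT : (0 < 4)%N)) ps.
by clear; lia.
Qed.

Lemma int_shift t b : tile_bounds t = real_bounds b ->
  exists x y, tile_shift t = real_point (x, y).
Proof.
rewrite /tile_bounds.
have -> : iter (tile_turns t) (@turn_bounds R) (proto_bounds R (tile_proto t)) =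
    real_bounds (iter (tile_turns t) (@turn_bounds int)
      (proto_bounds int (tile_proto t))).
  elim: (tile_turns t) => [|k IH] /=; first exact: real_proto_bounds.
  by rewrite IH real_turn_bounds.
set b0 := iter _ _ _ => -[ex _ ey _ _ _ _ _].
exists (xlo b - xlo b0), (ylo b - ylo b0).
rewrite [LHS]surjective_pairing /real_point /= !rmorphB /= -ex -ey.
by congr pair; rewrite addrC addKr.
Qed.

Lemma code_coloured c t b : tile_bounds t = real_bounds b ->
  (2 %| colour_bound b - c)%Z -> coloured_tile c t.
Proof.
move=> tb col; have [x [y e]] := int_shift tb.
have k4 := ltn_pmod (tile_turns t) (isT : (0 < 4)%N).
have bE : b = code_bounds (tile_proto t) (tile_turns t %% 4) x y.
  by apply: real_bounds_inj; rewrite -tb (tile_code e).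
move=> v; rewrite real_colour_vertices => /mapP[p ps ->].
exists (int_place (tile_turns t %% 4) x y p); first exact: real_place.
have := colour_boundP x y (tile_ok t) k4 ps.
by rewrite -bE; move: col; clear; lia.
Qed.

Lemma code_nondegenerate s k x y : proto_ok s -> (k < 4)%N ->
  let b := code_bounds s k x y in xlo b < xhi b /\ ylo b < yhi b.
Proof.
by case: s => [||a b|a|a|a] /= ok; case: k => [|[|[|[|k]]]] //= _; lia.
Qed.

Section Rectangle.
Variables m n : nat.
Hypotheses (hm : (2 <= m)%N) (hn : (2 <= n)%N).
Local Notation D := (rectangle R m n).
Local Notation M := (m%:Z - 1).
Local Notation N := (n%:Z - 1).
Variable c : int.
Hypothesis c01 : 0 <= c <= 1.

Definition dashed_on_boundary t : Prop :=
  forall A, dashed_side t A -> A `<=` boundary D.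

Lemma width_ge1 : 1 <= M. Proof. by move: hm; clear; lia. Qed.
Lemma height_ge1 : 1 <= N. Proof. by move: hn; clear; lia. Qed.

Lemma widthE : M%:~R = m%:R - 1 :> R.
Proof. by rewrite rmorphB /= rmorph1 -pmulrn. Qed.

Lemma heightE : N%:~R = n%:R - 1 :> R.
Proof. by rewrite rmorphB /= rmorph1 -pmulrn. Qed.

Lemma tile_sub_rect t b : tile_bounds t = real_bounds b ->
  tile_region t `<=` D -> [/\ 0 <= xlo b, xhi b <= M, 0 <= ylo b & yhi b <= N].
Proof.
move=> tb; rewrite tile_regionE => sub; have [] := tile_tight t; rewrite tb /=.
rewrite tb in sub.
move=> [p1 /sub[+ _] e1] [p2 /sub[+ _] e2] [p3 /sub[_ +] e3] [p4 /sub[_ +] e4] _ _ _ _.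
rewrite e1 e2 e3 e4 -widthE -heightE !ler_int ler0z.
by move=> /andP[? _] /andP[_ ?] /andP[+ _] /andP[_ ?]; rewrite ler0z.
Qed.

Lemma dash_ok_of_boundary t x y :
  tile_shift t = real_point (x, y) -> tile_region t `<=` D ->
  dashed_on_boundary t ->
  dash_ok M N (code_bounds (tile_proto t) (tile_turns t %% 4) x y).
Proof.
move=> e sub dash; have tb := tile_code e.
have k4 := ltn_pmod (tile_turns t) (isT : (0 < 4)%N).
have [r1 r2 r3 r4] := tile_sub_rect tb sub.
have [xx yy] := code_nondegenerate x y (tile_ok t) k4.
have [d1 d2 d3 d4] := dashed_exists x y (tile_ok t) k4.
set b := code_bounds _ _ _ _ in tb r1 r2 r3 r4 xx yy d1 d2 d3 d4 *.
have [x1 y1] : (xlo b)%:~R < (xhi b)%:~R :> R /\ (ylo b)%:~R < (yhi b)%:~R :> R.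
  by rewrite !ltr_int.
have [s1 s2 s3 s4] : [/\ 0 <= (xlo b)%:~R :> R, (xhi b)%:~R <= m%:R - 1 :> R,
    0 <= (ylo b)%:~R :> R & (yhi b)%:~R <= n%:R - 1 :> R].
  by rewrite -widthE -heightE !ler_int !ler0z.
(* The midpoint of the dashed side is tested: an end might be on the boundary because of a
   perpendicular side of the rectangle, whereas the midpoint is strictly between those. *)
have side p q : (exists2 e, e \in int_dashed (tile_proto t) &
      int_place (tile_turns t %% 4) x y e.1 = p /\
        int_place (tile_turns t %% 4) x y e.2 = q \/
      int_place (tile_turns t %% 4) x y e.1 = q /\
        int_place (tile_turns t %% 4) x y e.2 = p) ->
    let z := (((real_point p).1 + (real_point q).1) / 2,
      ((real_point p).2 + (real_point q).2) / 2) in D z ->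
    [\/ z.1 = 0, z.1 = m%:R - 1, z.2 = 0 | z.2 = n%:R - 1].
  move=> [[e1 e2] es pq] z Dz; apply/(boundary_rectangle Dz); rewrite /= in pq.
  have ds : dashed_side t
      (conv_hull [:: place t (real_point e1); place t (real_point e2)]).
    exists (real_point e1, real_point e2) => //.
    by rewrite real_dashed; apply/mapP; exists (e1, e2).
  have inb := dash _ ds z; apply: inb; rewrite !(real_place _ e).
  have half : 0 <= (2^-1 : R) <= 1.
    by rewrite invr_ge0 ler0n invf_le1 ?ltr0n // ler1n.
  have v1 : conv_hull [:: real_point p; real_point q] (real_point p).
    by apply: conv_hull_vertex; rewrite !inE eqxx.
  have v2 : conv_hull [:: real_point p; real_point q] (real_point q).
    by apply: conv_hull_vertex; rewrite !inE eqxx orbT.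
  have w1 : conv_hull [:: real_point q; real_point p] (real_point p).
    by apply: conv_hull_vertex; rewrite !inE eqxx orbT.
  have w2 : conv_hull [:: real_point q; real_point p] (real_point q).
    by apply: conv_hull_vertex; rewrite !inE eqxx.
  have zE : ((1 - 2^-1) * (real_point p).1 + 2^-1 * (real_point q).1,
      (1 - 2^-1) * (real_point p).2 + 2^-1 * (real_point q).2) = z.
    by rewrite /z; congr pair; field.
  case: pq => -[-> ->]; rewrite -zE; exact: conv_hull_convex.
clear dash sub; have eq0 (z : int) : z%:~R = 0 :> R -> z == 0 by move/eqP; rewrite intr_eq0.
have eqN (z : int) : z%:~R = n%:R - 1 :> R -> z == N.
  by rewrite -heightE => /intr_inj ->.
have eqM (z : int) : z%:~R = m%:R - 1 :> R -> z == M.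
  by rewrite -widthE => /intr_inj ->.
clearbody b; rewrite /dash_ok; apply/and4P; split; apply/implyP => hd.
- apply: eq0; move: (side _ _ (d1 hd)); clear -hm hn c01 x1 y1 s1 s2 s3 s4.
  set z := (_, _); move=> h; have Dz : D z by split; rewrite /=; lra.
  by case: (h Dz); rewrite /=; lra.
- apply: eqN; move: (side _ _ (d2 hd)); clear -hm hn c01 x1 y1 s1 s2 s3 s4.
  set z := (_, _); move=> h; have Dz : D z by split; rewrite /=; lra.
  by case: (h Dz); rewrite /=; lra.
- apply: eq0; move: (side _ _ (d3 hd)); clear -hm hn c01 x1 y1 s1 s2 s3 s4.
  set z := (_, _); move=> h; have Dz : D z by split; rewrite /=; lra.
  by case: (h Dz); rewrite /=; lra.
- apply: eqM; move: (side _ _ (d4 hd)); clear -hm hn c01 x1 y1 s1 s2 s3 s4.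
  set z := (_, _); move=> h; have Dz : D z by split; rewrite /=; lra.
  by case: (h Dz); rewrite /=; lra.
Qed.

Lemma boundary_of_dash_ok t b : tile_bounds t = real_bounds b ->
  tile_region t `<=` D -> dash_ok M N b -> dashed_on_boundary t.
Proof.
move=> tb sub dok; have [x [y e]] := int_shift tb.
have k4 := ltn_pmod (tile_turns t) (isT : (0 < 4)%N).
have bE : b = code_bounds (tile_proto t) (tile_turns t %% 4) x y.
  by apply: real_bounds_inj; rewrite -tb (tile_code e).
move=> A [e0]; rewrite real_dashed => /mapP[e' es ->] /= -> p hp.
have vert q : q \in int_dashed (tile_proto t) ->
    q.1 \in int_vertices (tile_proto t) /\ q.2 \in int_vertices (tile_proto t).
  case: (tile_proto t) => [||a1 b1|a|a|a] //=; rewrite !inE.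
    by move=> /eqP -> /=; rewrite !eqxx ?orbT.
  by case/orP => /eqP -> /=; rewrite !eqxx ?orbT.
have inr q : q \in int_vertices (tile_proto t) ->
    region (tile_bounds t) (place t (real_point q)).
  move=> qs; rewrite -tile_regionE; apply: conv_hull_vertex; apply: map_f.
  by rewrite real_vertices; apply: map_f.
have [/inr v1 /inr v2] := vert _ es.
have Dp : D p.
  apply: sub; rewrite tile_regionE; apply: (conv_hull_region _ hp) => v.
  by rewrite !inE => /orP[] /eqP ->.
apply/(boundary_rectangle Dp).
have level (a a' z : R) :
    a * (place t (real_point e'.1)).1 + a' * (place t (real_point e'.1)).2 = z ->
    a * (place t (real_point e'.2)).1 + a' * (place t (real_point e'.2)).2 = z ->
    a * p.1 + a' * p.2 <= z.
  move=> h1 h2; apply: (conv_hull_le _ hp) => v.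
  by rewrite !inE => /orP[] /eqP ->; rewrite ?h1 ?h2.
have level1 (z : R) : (place t (real_point e'.1)).1 = z ->
    (place t (real_point e'.2)).1 = z -> p.1 = z.
  move=> h1 h2; have := level 1 0 z; have := level (-1) 0 (- z).
  rewrite h1 h2 !mul0r !addr0 !mulN1r !mul1r lerN2.
  by move=> /(_ erefl erefl) l1 /(_ erefl erefl) l2; apply/le_anti; rewrite l1 l2.
have level2 (z : R) : (place t (real_point e'.1)).2 = z ->
    (place t (real_point e'.2)).2 = z -> p.2 = z.
  move=> h1 h2; have := level 0 1 z; have := level 0 (-1) (- z).
  rewrite h1 h2 !mul0r !add0r !mulN1r !mul1r lerN2.
  by move=> /(_ erefl erefl) l1 /(_ erefl erefl) l2; apply/le_anti; rewrite l1 l2.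
rewrite !(real_place _ e) in level1 level2.
move: dok => /and4P[/implyP o1 /implyP o2 /implyP o3 /implyP o4].
case: (dashedP x y (tile_ok t) k4 es); rewrite -bE => -[hd [h1 h2]].
- apply: Or43; rewrite (level2 (ylo b)%:~R (congr1 _ h1) (congr1 _ h2)).
  by rewrite (eqP (o1 hd)).
- apply: Or44; rewrite (level2 (yhi b)%:~R (congr1 _ h1) (congr1 _ h2)).
  by rewrite (eqP (o2 hd)) heightE.
- apply: Or41; rewrite (level1 (xlo b)%:~R (congr1 _ h1) (congr1 _ h2)).
  by rewrite (eqP (o3 hd)).
- apply: Or42; rewrite (level1 (xhi b)%:~R (congr1 _ h1) (congr1 _ h2)).
  by rewrite (eqP (o4 hd)) widthE.
Qed.

Definition ctile_region s : set (R * R) :=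
  region (real_bounds (ctile_bounds M N c s)).
Local Notation valid := (valid M N c).

Lemma tile_ctile t : coloured_tile c t -> tile_region t `<=` D ->
  dashed_on_boundary t ->
  exists2 s, valid s & tile_region t = ctile_region s.
Proof.
move=> col sub dash; have [x [y [e col2]]] := coloured_tile_code col.
have tb := tile_code e.
have k4 := ltn_pmod (tile_turns t) (isT : (0 < 4)%N).
have [s vs bE] := code_ctile width_ge1 height_ge1 c01 (tile_ok t) k4 col2 (tile_sub_rect tb sub)
  (dash_ok_of_boundary e sub dash).
by exists s => //; rewrite tile_regionE tb bE.
Qed.

Lemma ctile_tile s : valid s -> exists2 t,
  tile_region t = ctile_region s & tile_bounds t = real_bounds (ctile_bounds M N c s).
Proof.
move=> /(ctile_code width_ge1 height_ge1 c01)[p [k [x [y [ok k4 e]]]]].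
have tb : tile_bounds (Tile k (real_point (x, y)) ok) =
    real_bounds (ctile_bounds M N c s).
  by rewrite (@tile_code _ x y) //= modn_small // e.
by exists (Tile k (real_point (x, y)) ok) => //; rewrite tile_regionE tb.
Qed.

Lemma ctile_region_tight s : valid s -> tight (@real_bounds R (ctile_bounds M N c s)).
Proof. by move=> /ctile_tile[t _ <-]; apply: tile_tight. Qed.

Lemma ctile_region_inj s s' : valid s -> valid s' ->
  ctile_region s = ctile_region s' -> s = s'.
Proof.
move=> v v' e; apply: (ctile_bounds_inj width_ge1 height_ge1 c01 v v').
by apply: real_bounds_inj; apply: region_inj e; apply: ctile_region_tight.
Qed.

Lemma ctile_region_sub s : valid s -> ctile_region s `<=` D.
Proof.
move=> v p [/andP[x1 x2] /andP[y1 y2] _ _].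
have [r1 r2 r3 r4] := ctile_in_rect width_ge1 height_ge1 c01 v.
rewrite /rectangle /= -widthE -heightE; split; apply/andP; split.
- by apply: le_trans x1; rewrite /= ler0z.
- by apply: (le_trans x2); rewrite /= ler_int.
- by apply: le_trans y1; rewrite /= ler0z.
- by apply: (le_trans y2); rewrite /= ler_int.
Qed.

(** The conditions on a tiling range over every [t] with the given region. All of them have the same
    bounds by [region_inj], and these fix the colour and the dashed sides. *)
Lemma ctile_region_ok s t : valid s -> tile_region t = ctile_region s ->
  coloured_tile c t /\ dashed_on_boundary t.
Proof.
move=> v e; have tb : tile_bounds t = real_bounds (ctile_bounds M N c s).
  apply: region_inj; [exact: tile_tight|exact: ctile_region_tight|].
  by rewrite -tile_regionE.
split; first by apply: code_coloured tb (ctile_colour width_ge1 height_ge1 c01 v).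
apply: boundary_of_dash_ok tb _ (ctile_dash_ok width_ge1 height_ge1 c01 v).
by rewrite e; apply: ctile_region_sub.
Qed.

End Rectangle.
End Link.

(** * The tiling of a kernel function *)

Section Tilings.
Context {R : realType}.
Variables m n : nat.
Hypotheses (hm : (2 <= m)%N) (hn : (2 <= n)%N).
Variable c : int.
Hypothesis c01 : 0 <= c <= 1.
Local Notation D := (rectangle R m n).
Local Notation M := (m%:Z - 1).
Local Notation N := (n%:Z - 1).
Local Notation M1 := (width_ge1 hm).
Local Notation N1 := (height_ge1 hn).
Local Notation lat := (lat c).
Local Notation in_rect := (in_rect M N).
Local Notation lat_kernel := (lat_kernel M N c).
Local Notation cell_rect := (cell_rect M N c).
Local Notation valid := (valid M N c).
Local Notation compat := (compat M N c).
Local Notation ctile_region := (@ctile_region R m n c).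
Local Notation cell_centre := (@cell_centre R c).

Definition coloured_tiling (T : set (set (R * R))) : Prop :=
  tiling D T /\ forall t, T (tile_region t) -> coloured_tile c t.

Definition kernel_tiling (u : int -> int -> bool) : set (set (R * R)) :=
  [set P | exists s, [/\ valid s, compat (lat u) s & P = ctile_region s]].

Lemma rectangleE (p : R * R) :
  D p <-> 0 <= p.1 <= M%:~R /\ 0 <= p.2 <= N%:~R.
Proof. by rewrite widthE heightE. Qed.

Lemma in_tile_interior s i j e f : valid s -> cell_rect i j e f ->
  in_tile s i j e f -> interior (ctile_region s) (cell_centre i j e f).
Proof.
move=> v cell it; have [he hf] := cell_rect01 cell.
by apply: cell_centre_interior he hf (in_tile_cell_in M1 N1 c01 v cell it).
Qed.

Lemma region_in_tile s i j e f (al be : R) : valid s -> cell_rect i j e f ->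
  0 < al -> 0 < be -> al + be < 1 ->
  ctile_region s (cell_point c i j e f al be) -> in_tile s i j e f.
Proof.
move=> v cell al0 be0 ab1 h; have [he hf] := cell_rect01 cell.
apply: (cell_meets_in_tile M1 N1 c01 v cell).
exact: cell_point_meets he hf al0 be0 ab1 h.
Qed.

Lemma centre_in_rect i j e f : cell_rect i j e f -> D (cell_centre i j e f).
Proof.
move=> cell; have [he hf] := cell_rect01 cell.
pose b := Bounds 0 M 0 N 0 (M + N) (- N) M.
have hb : cell_in_bounds c b i j e f.
  have e01 : e = 0 \/ e = 1 by clear -he; lia.
  have f01 : f = 0 \/ f = 1 by clear -hf; lia.
  case/and5P: cell => _ _; rewrite /gap_rect /lat_rect /in_rect /cell_in_bounds.
  rewrite /in_bounds /b /= => w rh rv; clear -e01 f01 w rh rv.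
  by case: e01 rh => ->; case: f01 rv => ->; lia.
have [] : region (real_bounds b) (cell_centre i j e f).
  exact: interior_subset (cell_centre_interior he hf hb).
by move=> /= h1 h2 _ _; apply/rectangleE.
Qed.

Lemma valid_cell s : valid s -> exists i j e f, cell_rect i j e f /\ in_tile s i j e f.
Proof.
case: s => [k l|i0 i1 j0 j1] v.
  exists k, l, 0, 0; rewrite /= !eqxx; split=> //.
  move: v M1 N1; rewrite /valid /cell_rect /gap_rect /lat_rect /in_rect.
  by clear; lia.
have [p [q [b r]]] := border_nonempty M1 N1 c01 v.
by have [i [j [e [f [cell it _]]]]] := border_cell M1 N1 c01 v b r; exists i, j, e, f.
Qed.

Lemma valid_finite : finite_set [set s | valid s].
Proof.
(* The coordinates of a valid tile are at most [m + n + 2] in absolute value; [z] lists these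
   [2 * (m + n + 2) + 1] integers. *)
pose K := (2 * (m + n) + 5)%N.
pose z (a : 'I_K) : int := a%:Z - (m + n + 2)%N%:Z.
pose F (a : bool * 'I_K * 'I_K * 'I_K * 'I_K) : ctile :=
  let: (d, a1, a2, a3, a4) := a in
  if d then Dia (z a1) (z a2) else Blk (z a1) (z a2) (z a3) (z a4).
apply: (@sub_finite_set _ _ (range F)); last first.
  by apply: finite_image; apply: finite_finset.
have zP (x : int) : - (m + n + 2)%N%:Z <= x <= (m + n + 2)%N%:Z -> exists a, z a = x.
  move=> hx; have lt : (absz (x + (m + n + 2)%N%:Z)%R < K)%N.
    by rewrite /K; clear -hx; lia.
  by exists (Ordinal lt); rewrite /z /=; clear -hx; lia.
case=> [i j|i0 i1 j0 j1] /= v.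
  have [a1 e1] : exists a, z a = i.
    by apply: zP; move: v M1 N1 c01; rewrite /valid; clear; lia.
  have [a2 e2] : exists a, z a = j.
    by apply: zP; move: v M1 N1 c01; rewrite /valid; clear; lia.
  by exists (true, a1, a2, a1, a1); rewrite //= e1 e2.
have : [/\ - (m + n + 2)%N%:Z <= i0 <= (m + n + 2)%N%:Z,
    - (m + n + 2)%N%:Z <= i1 <= (m + n + 2)%N%:Z,
    - (m + n + 2)%N%:Z <= j0 <= (m + n + 2)%N%:Z &
    - (m + n + 2)%N%:Z <= j1 <= (m + n + 2)%N%:Z].
  have c01' := c01; have M1' := M1; have N1' := N1.
  have v' : valid (Blk i0 i1 j0 j1) := v; clear v.
  by case: (blkP M1 N1 c01 v') => ? ? ? ? ? ?; split; lia.
move=> [/zP[a1 e1] /zP[a2 e2] /zP[a3 e3] /zP[a4 e4]].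
by exists (false, a1, a2, a3, a4); rewrite //= e1 e2 e3 e4.
Qed.

Lemma kernel_tiling_tiling (u : int -> int -> bool) :
  (forall x y, u x y -> in_rect x y) -> lat_kernel (lat u) ->
  (exists i j, lat u i j) -> coloured_tiling (kernel_tiling u).
Proof.
move=> usupp uker unz.
have exi := compat_tile_exists M1 N1 c01 usupp uker unz.
have col t : kernel_tiling u (tile_region t) ->
    coloured_tile c t /\ dashed_on_boundary m n t.
  by move=> [s [v _ e]]; apply: (ctile_region_ok hm hn c01 v e).
split; last by move=> t /col[].
split.
- apply: (@sub_finite_set _ _ (ctile_region @` [set s | valid s])).
    by move=> _ [s [v _ ->]]; exists s.
  by apply: finite_image; apply: valid_finite.
- move=> _ [s [v _ ->]]; have [t e _] := @ctile_tile R m n hm hn c c01 s v.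
  by exists t.
- apply/seteqP; split=> [p [_ [s [v _ ->]]]|p Dp].
    exact: (ctile_region_sub hm hn c01 v).
  have [h1 h2] := (rectangleE p).1 Dp.
  have [i [j [e [f [al [be [cell -> al0 be0 ab1]]]]]]] := cell_cover M1 N1 c01 h1 h2.
  have [s [v cs it]] := exi _ _ _ _ cell; exists (ctile_region s); first by exists s.
  have [he hf] := cell_rect01 cell.
  exact: cell_point_region he hf (in_tile_cell_in M1 N1 c01 v cell it) al0 be0 ab1.
(* The common point [p] may lie on an edge of a half square. A short move towards the centre of a
   half square containing it gives a common point strictly inside, so both tiles contain that half
   square. *)
- move=> _ _ [s [v cs ->]] [s' [v' cs' ->]] [p [ip ip']].
  have [h1 h2] := (rectangleE p).1 (ctile_region_sub hm hn c01 v (interior_subset ip)).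
  have [i [j [e [f [al [be [cell pE al0 be0 ab1]]]]]]] := cell_cover M1 N1 c01 h1 h2.
  have [l /andP[l0 l1] [r r']] := interior_segment (cell_centre i j e f) ip ip'.
  have rE : (p.1 + l * ((cell_centre i j e f).1 - p.1),
      p.2 + l * ((cell_centre i j e f).2 - p.2)) =
      cell_point c i j e f ((1 - l) * al + l / 4) ((1 - l) * be + l / 4).
    by rewrite pE /cell_centre /cell_point /=; congr pair; field.
  rewrite rE in r r'.
  have la : 0 <= (1 - l) * al by rewrite mulr_ge0 // subr_ge0.
  have lb : 0 <= (1 - l) * be by rewrite mulr_ge0 // subr_ge0.
  have lab : (1 - l) * al + (1 - l) * be <= 1 - l.
    by rewrite -mulrDr ler_piMr // subr_ge0.
  have a0 : 0 < (1 - l) * al + l / 4 by clear -hm hn c01 la l0; lra.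
  have b0 : 0 < (1 - l) * be + l / 4 by clear -hm hn c01 lb l0; lra.
  have ab : (1 - l) * al + l / 4 + ((1 - l) * be + l / 4) < 1.
    by clear -hm hn c01 lab l0; lra.
  have it := region_in_tile v cell a0 b0 ab r.
  have it' := region_in_tile v' cell a0 b0 ab r'.
  by rewrite (compat_tile_unique M1 N1 c01 usupp uker v v' cs cs' cell it it').
- by move=> t A /col[_ dash]; apply: dash.
Qed.

Lemma kernel_tiling_inj (u u' : int -> int -> bool) :
  (forall x y, u x y -> in_rect x y) -> lat_kernel (lat u) ->
  (exists i j, lat u i j) ->
  kernel_tiling u = kernel_tiling u' ->
  forall i j, lat_rect M N c i j -> lat u i j = lat u' i j.
Proof.
move=> usupp uker unz eT p q /(point_cell M1 N1 c01)[i [j [e [f [cell <- <-]]]]].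
have [s [v cs it]] := compat_tile_exists M1 N1 c01 usupp uker unz cell.
have : kernel_tiling u (ctile_region s) by exists s.
rewrite eT => -[s' [v' cs' e']].
have es := ctile_region_inj hm hn c01 v v' e'; rewrite -es in cs'.
rewrite (compat_value cs cell it).
by rewrite (compat_value cs' cell it).
Qed.

Lemma kernel_tiling_surj (T : set (set (R * R))) : coloured_tiling T ->
  exists u : int -> int -> bool, [/\ forall x y, u x y -> in_rect x y,
    lat_kernel (lat u), exists i j, lat u i j & kernel_tiling u = T].
Proof.
move=> [[_ Tran Tcov Ttriv Tdash] Tcol].
have rep P : T P -> exists2 s, valid s & P = ctile_region s.
  move=> TP; have [t _ tP] := Tran _ TP; rewrite -tP in TP *.
  apply: (tile_ctile hm hn c01 (Tcol _ TP)) => [p tp|A dA].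
    by rewrite -Tcov; exists (tile_region t).
  exact: Tdash dA.
pose S s := valid s /\ T (ctile_region s).
have Suniq s s' i j e f : S s -> S s' -> cell_rect i j e f ->
    in_tile s i j e f -> in_tile s' i j e f -> s = s'.
  move=> [v Ts] [v' Ts'] cell it it'; apply: (ctile_region_inj hm hn c01 v v').
  apply: Ttriv => //; exists (cell_centre i j e f).
  by split; apply: in_tile_interior.
have Scov i j e f : cell_rect i j e f -> exists2 s, S s & in_tile s i j e f.
  move=> cell; have := centre_in_rect cell; rewrite -Tcov => -[P TP Pq].
  have [s v es] := rep _ TP; rewrite es in TP Pq; exists s => //.
  by apply: region_in_tile v cell _ _ _ Pq; lra.
have [u [usupp uker unz comp]] := kernel_of_exact_cover M1 N1 c01
  (fun s (h : S s) => h.1) Scov Suniq.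
exists u; split=> //; apply/seteqP; split=> [_ [s [v cs ->]]|P TP].
  (* A compatible tile contains some half square. The tile of [T] there is compatible as well, so
     the two coincide. *)
  have [i [j [e [f [cell it]]]]] := valid_cell v.
  have [s' Ss' it'] := Scov _ _ _ _ cell.
  rewrite (compat_tile_unique M1 N1 c01 usupp uker v Ss'.1 cs (comp _ Ss') cell it it').
  exact: Ss'.2.
have [s v es] := rep _ TP; exists s; split=> //.
by apply: comp; split=> //; rewrite -es.
Qed.

End Tilings.

(** * Grid functions with values in the field of two elements *)

Section GridFunctions.
Variables m n : nat.
Hypotheses (hm : (2 <= m)%N) (hn : (2 <= n)%N).
Variable c : int.
Hypothesis c01 : 0 <= c <= 1.
Variables P Q : pred (grid_point m n).
Hypothesis PE : forall p, P p = (2 %| p.1%:Z + p.2%:Z - c)%Z.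
Hypothesis QE : forall p, Q p = ~~ P p.
Local Notation V := {ffun {p : grid_point m n | P p} -> 'F_2}.
Local Notation M := (m%:Z - 1).
Local Notation N := (n%:Z - 1).
Local Notation in_rect := (in_rect M N).
Local Notation lat_rect := (lat_rect M N c).

(** At most one term occurs, and the empty sum gives zero off the grid and off the colour without a
    membership test. *)
Definition extend (u : V) (x y : int) : 'F_2 :=
  \sum_(b : {p : grid_point m n | P p} | ((val b).1%:Z == x) && ((val b).2%:Z == y)) u b.

Definition support_fun (u : V) (x y : int) : bool := extend u x y != 0.

Definition grid_kernel : set V := [set u |
  forall w : {p : grid_point m n | Q p}, \sum_(b : {p : grid_point m n | P p} | adj (val b) (val w)) u b = 0].

Lemma extend_val (u : V) (b : {p : grid_point m n | P p}) : extend u (val b).1%:Z (val b).2%:Z = u b.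
Proof.
by rewrite /extend (big_pred1 b).
Qed.

Lemma support_fun_rect u x y : support_fun u x y -> in_rect x y.
Proof.
rewrite /support_fun; apply: contraNT => out; rewrite /extend big1 // => b.
move=> /andP[/eqP e1 /eqP e2]; move: out; rewrite -e1 -e2 /in_rect.
by case: (val b) => b1 b2 /=; move: (ltn_ord b1) (ltn_ord b2); clear; lia.
Qed.

Lemma F2_bool (z : 'F_2) : z = (z != 0)%:R.
Proof. by case: z => -[|[|k]] //= lt; apply: val_inj. Qed.

Lemma sum_adj (u : V) (w : grid_point m n) :
  let x := w.1%:Z in let y := w.2%:Z in
  \sum_(b : {p : grid_point m n | P p} | adj (val b) w) u b =
  extend u (x - 1) y + extend u (x + 1) y + extend u x (y + 1) + extend u x (y - 1).
Proof.
have cond (p : pred {p : grid_point m n | P p}) :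
    \sum_(b | p b) u b = \sum_b (if p b then u b else 0) by rewrite big_mkcond.
rewrite /= /extend !cond -!big_split /=; apply: eq_bigr => b _; rewrite /adj.
move: (val b).1 (val b).2 (w.1) (w.2) => b1 b2 w1 w2.
have [h|[h|[h|[h|h]]]] :
    b1%:Z = w1%:Z - 1 /\ b2%:Z = w2%:Z \/ b1%:Z = w1%:Z + 1 /\ b2%:Z = w2%:Z \/
    b1%:Z = w1%:Z /\ b2%:Z = w2%:Z + 1 \/ b1%:Z = w1%:Z /\ b2%:Z = w2%:Z - 1 \/
    `|b1%:Z - w1%:Z| + `|b2%:Z - w2%:Z| <> 1 by lia.
- do 5!(case: ifP => ?); rewrite ?(addr0, add0r) //; lia.
- do 5!(case: ifP => ?); rewrite ?(addr0, add0r) //; lia.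
- do 5!(case: ifP => ?); rewrite ?(addr0, add0r) //; lia.
- do 5!(case: ifP => ?); rewrite ?(addr0, add0r) //; lia.
- do 5!(case: ifP => ?); rewrite ?(addr0, add0r) //; lia.
Qed.

Lemma F2_sum4 (a b d e : 'F_2) :
  (a + b + d + e == 0) = ((a != 0) (+) (b != 0) (+) (d != 0) (+) (e != 0) == false).
Proof.
rewrite {1}(F2_bool a) {1}(F2_bool b) {1}(F2_bool d) {1}(F2_bool e).
by case: (a != 0); case: (b != 0); case: (d != 0); case: (e != 0).
Qed.

Lemma grid_kernelP (u : V) :
  grid_kernel u <-> lat_kernel M N c (lat c (support_fun u)).
Proof.
have sumE (w : grid_point m n) i j : w.1%:Z = i + j + 1 + c -> w.2%:Z = i - j ->
    (\sum_(b : {p : grid_point m n | P p} | adj (val b) w) u b == 0) =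
    (lat c (support_fun u) i j (+) lat c (support_fun u) (i + 1) (j + 1)
      (+) lat c (support_fun u) (i + 1) j (+) lat c (support_fun u) i (j + 1)
      == false).
  move=> ex ey; rewrite sum_adj ex ey F2_sum4 /lat /support_fun.
  by congr ((extend u _ _ != 0) (+) (extend u _ _ != 0) (+) (extend u _ _ != 0)
    (+) (extend u _ _ != 0) == false); lia.
split=> [uk i j gap|uk w].
  have [lx ly] : (absz (i + j + 1 + c)%R < m)%N /\ (absz (i - j)%R < n)%N.
    by move: gap hm hn; rewrite /gap_rect /in_rect; clear; lia.
  pose w : grid_point m n := (Ordinal lx, Ordinal ly).
  have [ex ey] : w.1%:Z = i + j + 1 + c /\ w.2%:Z = i - j.
    by move: gap; rewrite /gap_rect /in_rect /=; clear; lia.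
  have Qw : Q w by rewrite QE PE ex ey; clear; lia.
  by apply/eqP; rewrite -(sumE w) //; apply/eqP; apply: (uk (exist _ w Qw)).
pose x := (val w).1%:Z; pose y := (val w).2%:Z.
have par : ~~ (2 %| x + y - c)%Z by rewrite -PE -QE; apply: valP w.
pose i := ((x + y - 1 - c)%R %/ 2)%Z; pose j := i - y.
have ex : x = i + j + 1 + c by move: par; rewrite /j /i; clear; lia.
have ey : y = i - j by rewrite /j; clear; lia.
apply/eqP; rewrite (sumE _ i j) //; apply/eqP; apply: uk.
rewrite /gap_rect /in_rect -ex -ey /x /y.
by case: (val w) => b1 b2 /=; move: (ltn_ord b1) (ltn_ord b2); clear; lia.
Qed.

Lemma support_fun_inj (u u' : V) :
  (forall i j, lat_rect i j -> lat c (support_fun u) i j = lat c (support_fun u') i j) ->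
  u = u'.
Proof.
move=> h; apply/ffunP => b; pose x := (val b).1%:Z; pose y := (val b).2%:Z.
have par : (2 %| x + y - c)%Z by rewrite -PE; apply: valP b.
pose i := ((x + y - c)%R %/ 2)%Z; pose j := i - y.
have ex : x = i + j + c by move: par; rewrite /j /i; clear; lia.
have ey : y = i - j by rewrite /j; clear; lia.
rewrite -!extend_val -/x -/y [LHS]F2_bool [RHS]F2_bool.
have := h i j; rewrite /lat -ex -ey /support_fun => -> //.
rewrite /lat_rect /in_rect -ex -ey /x /y.
by case: (val b) => b1 b2 /=; move: (ltn_ord b1) (ltn_ord b2); clear; lia.
Qed.

Lemma support_fun_surj (v : int -> int -> bool) :
  (forall x y, v x y -> in_rect x y) ->
  exists u : V, lat c (support_fun u) = lat c v.
Proof.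
move=> vsupp; exists [ffun b : {p : grid_point m n | P p} =>
  (v (val b).1%:Z (val b).2%:Z)%:R : 'F_2].
apply/funext => i; apply/funext => j; rewrite /lat.
have [r|r] := boolP (in_rect (i + j + c) (i - j)); last first.
  by rewrite (contraNF (@support_fun_rect _ _ _) r) (contraNF (@vsupp _ _) r).
have [lx ly] : (absz (i + j + c)%R < m)%N /\ (absz (i - j)%R < n)%N.
  by move: r hm hn; rewrite /in_rect; clear; lia.
pose w : grid_point m n := (Ordinal lx, Ordinal ly).
have [ex ey] : w.1%:Z = i + j + c /\ w.2%:Z = i - j.
  by move: r; rewrite /in_rect /=; clear; lia.
have Pw : P w by rewrite PE ex ey; clear; lia.
rewrite /support_fun -ex -ey (extend_val _ (exist _ w Pw)) ffunE /=.
by case: (v _ _).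
Qed.

Lemma kernel_tiling_bij (R : realType) :
  set_bij (grid_kernel `\ 0) (coloured_tiling m n c)
    (fun u => @kernel_tiling R m n c (support_fun u)).
Proof.
have nz (u : V) : u != 0 -> exists i j, lat c (support_fun u) i j.
  move=> u0; apply/not_existsP => h; case/eqP: u0; apply: support_fun_inj => i j _.
  have -> : lat c (support_fun 0) i j = false.
    by rewrite /lat /support_fun /extend big1 ?eqxx // => b _; rewrite ffunE.
  by apply/negbTE/negP => hij; apply: (h i); exists j.
have facts (u : V) : (grid_kernel `\ 0) u ->
    [/\ forall x y, support_fun u x y -> in_rect x y,
      lat_kernel M N c (lat c (support_fun u))
    & exists i j, lat c (support_fun u) i j].
  move=> [/grid_kernelP k /eqP u0]; split=> //; last exact: nz.
  exact: support_fun_rect.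
split.
- by move=> u /facts[h1 h2 h3]; apply: kernel_tiling_tiling.
- move=> u u'; rewrite !inE => /facts[h1 h2 h3] /facts[h1' h2' h3'] e.
  apply: support_fun_inj; exact: kernel_tiling_inj h1 h2 h3 e.
- move=> T /(kernel_tiling_surj hm hn c01)[v [h1 h2 h3 e]].
  have [u ue] := support_fun_surj h1; exists u.
    split; first by apply/grid_kernelP; rewrite ue.
    move=> u0; have [i [j]] := h3; rewrite -ue u0 /lat /support_fun /extend.
    by rewrite big1 ?eqxx // => b _; rewrite ffunE.
  by rewrite -e /kernel_tiling ue.
Qed.

End GridFunctions.

Theorem theorem2 (R : realType) (m n : nat) (hm : (2 <= m)%N) (hn : (2 <= n)%N) :
  (exists Phib : Vb m n -> set (set (R * R)),
     set_bij (kerBW m n `\ 0) (black_tilings (rectangle R m n)) Phib) /\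
  (exists Phiw : Vw m n -> set (set (R * R)),
     set_bij (kerWB m n `\ 0) (white_tilings (rectangle R m n)) Phiw).
Proof.
have vertexE (c : int) (p : R * R) : coloured_point c p <->
    exists x y : int, p = (x%:~R, y%:~R) /\ (2 %| x + y - c)%Z.
  by split=> [[[x y] -> h]|[x [y [-> h]]]]; [exists x, y|exists (x, y)].
have blackP (t : tile (R := R)) : coloured_tile 0 t <-> black_tile t.
  have pointE p : coloured_point 0 p <-> @black_point R p.
    rewrite vertexE; split=> -[x [y [-> h]]]; exists x, y; split=> //.
      by rewrite subr0 in h.
    by rewrite subr0.
  by split=> h v /h /pointE.
have whiteP (t : tile (R := R)) : coloured_tile 1 t <-> white_tile t.
  have pointE p : coloured_point 1 p <-> @white_point R p.
    rewrite vertexE; split=> -[x [y [-> h]]]; exists x, y; split=> //; clear -h; lia.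
  by split=> h v /h /pointE.
split.
- have b01 : 0 <= (0 : int) <= 1 by [].
  have blackE (p : grid_point m n) : black p = (2 %| p.1%:Z + p.2%:Z - 0)%Z.
    by case: p => p1 p2; rewrite /black /=; clear; lia.
  exists (fun u => kernel_tiling m n 0 (support_fun u)).
  have := kernel_tiling_bij hm hn b01 blackE (fun p => erefl (white p)) R.
  have -> : coloured_tiling m n 0 = black_tilings (rectangle R m n).
    by apply/seteqP; split=> T [h1 h2]; split=> // t /h2 /blackP.
  have -> : grid_kernel (m := m) (n := n) (P := @black m n) (@white m n) = kerBW m n.
    apply/seteqP; split=> u uk.
      by apply/ffunP => w; rewrite !ffunE; apply: uk.
    by move=> w; move/ffunP: uk => /(_ w); rewrite !ffunE.
  by [].
have w01 : 0 <= (1 : int) <= 1 by [].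
have whiteE (p : grid_point m n) : white p = (2 %| p.1%:Z + p.2%:Z - 1)%Z.
  by case: p => p1 p2; rewrite /white /black /=; clear; lia.
have blackE (p : grid_point m n) : black p = ~~ white p by rewrite /white negbK.
exists (fun u => kernel_tiling m n 1 (support_fun u)).
have := kernel_tiling_bij hm hn w01 whiteE blackE R.
have -> : coloured_tiling m n 1 = white_tilings (rectangle R m n).
  by apply/seteqP; split=> T [h1 h2]; split=> // t /h2 /whiteP.
have -> : grid_kernel (m := m) (n := n) (P := @white m n) (@black m n) = kerWB m n.
  apply/seteqP; split=> u uk.
    by apply/ffunP => w; rewrite !ffunE; apply: uk.
  by move=> w; move/ffunP: uk => /(_ w); rewrite !ffunE.
by [].
Qed.
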